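(* Let $(\Sigma^n,g,h,u,\mu,\lambda)$ be a non-compact gradient Einstein-type structure with $\mu>-\frac{f'(h)}{f(h)}$, isometrically immersed by $\phi$ into $I\times_f M^n$ with potential function $h=\pi_I\circ\phi$, where the fiber $M^n$ has sectional curvature $k_M\le\inf_I(f'^2-ff'')$. Suppose $A(\nabla h)=\rho\nabla h$ for some smooth function $\rho$, and set $$\Delta:=(nH+\theta)^2+4\left[\frac{f'(h)}{f(h)}-(n-1)\frac{f''(h)}{f(h)}-\lambda\right].$$ Then the following statements hold. (a) If $\Delta\le 0$, then $(\Sigma^n,g)$ is Einstein harmonic (i.e. $h$ is constant). (b) If $\Delta>0$ and $$\rho\le\frac{nH+\theta-\sqrt{\Delta}}{2}\qquad\text{or}\qquad\frac{nH+\theta+\sqrt{\Delta}}{2}\le\rho,$$ then $(\Sigma^n,g)$ is Einstein harmonic.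
   Context: A gradient Einstein-type structure $(\Sigma^n,g,h,u,\mu,\lambda)$ consists of a connected, complete Riemannian manifold $(\Sigma^n,g)$, a real number $\alpha>0$, a smooth map $u:(\Sigma^n,g)\to(N^p,g')$ into a Riemannian manifold, with tension field $\tau_g u=\mathrm{trace}\,\nabla(du)$, and smooth functions $h,\mu,\lambda$ on $\Sigma$ such that $Ric_g-\alpha u^*g'+\mathrm{Hess}\,h-\mu\,dh\otimes dh=\lambda g$ and $\tau_g u=du(\nabla h)$. It is called Einstein harmonic (trivial) if $h$ is constant, so that $Ric_g-\alpha u^*g'=\lambda g$ and $\tau_g u=0$. $I\times_f M^n$ is $I\times M^n$ with metric $\langle\,,\rangle=\pi_I^*(dt^2)+f^2(\pi_I)\pi_M^*(g_M)$, where $I\subset\mathbb{R}$ is an open interval, $f:I\to(0,\infty)$ is smooth, and $M^n$ is a connected oriented Riemannian manifold. For an oriented hypersurface $\Sigma^n$ with unit normal $\nu$, the shape operator is $AX=-\overline\nabla_X\nu$, the mean curvature $H$ is given by $nH=\mathrm{tr}\,A$, and the angle function is $\theta=\langle\nu,\partial_t\rangle$. *)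

(* Defs.v *)
From mathcomp Require Import all_boot all_order all_algebra.
From mathcomp Require Import all_classical all_reals all_analysis.
Import Order.TTheory GRing.Theory Num.Theory.
Import numFieldNormedType.Exports.

Set Implicit Arguments.
Unset Strict Implicit.
Unset Printing Implicit Defensive.

Local Open Scope ring_scope.
Local Open Scope classical_set_scope.

(* Conventions.  Riemannian geometry is done by components in charts.  A
   tensor field is a family, indexed by the charts, of component functions of
   the *point* (not of its coordinates), meaningful on the chart domain.
   Tangent vectors are row vectors: v stands for \sum_i (v 0 i) d_i.
   Bilinear forms are matrices of their values on (d_i, d_j).  A linear map L
   is the matrix whose i-th row is L(d_i), so that L v is v *m L. *)

(* [param c] is the inverse of [coord c], and is only meaningful on
   [coord c @` dom c].  This record is raw data; its laws are in
   [is_riemannian]. *)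
Record chartedMetric (R : realType) (n : nat) := ChartedMetric {
  points :> topologicalType;
  chart : Type;
  dom : chart -> set points;
  coord : chart -> points -> 'rV[R]_n;
  param : chart -> 'rV[R]_n -> points;
  metric : chart -> points -> 'M[R]_n }.

Arguments dom {R n c} _ _.
Arguments coord {R n c} _ _.
Arguments param {R n c} _ _.
Arguments metric {R n c} _ _.

Section Calculus.
Variables (R : realType) (n : nat) (X : chartedMetric R n).
Implicit Types (a b : chart X) (F h : X -> R) (p : X) (i j k l : 'I_n).

(* d_i F *)
Definition pd a i F : X -> R :=
  fun p => 'D_(delta_mx 0 i : 'rV[R]_n) (F \o param a) (coord a p).

(* d_(i1) ... d_(ir) F for s = [:: i1; ...; ir] *)
Definition iter_pd a (s : seq 'I_n) F : X -> R := foldr (pd a) F s.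

(* F is C^oo on dom a `&` U: all iterated partial derivatives exist and are
   continuous there. *)
Definition smooth_in a (U : set X) F :=
  forall (s : seq 'I_n) p, dom a p -> U p ->
    {for p, continuous (iter_pd a s F)} /\
    forall i, derivable (iter_pd a s F \o param a) (coord a p)
                        (delta_mx 0 i : 'rV[R]_n).

Definition smooth_fun F := forall a, smooth_in a setT F.

Definition inner a p (v w : 'rV[R]_n) : R := (v *m metric a p *m w^T) 0 0.

(* dh, as a row of components *)
Definition dfun a h p : 'rV[R]_n := \row_i pd a i h p.

Definition grad a h p : 'rV[R]_n := dfun a h p *m invmx (metric a p).

(* Christoffel symbol Gamma^k_(ij) of the Levi-Civita connection *)
Definition christoffel a k i j p : R :=
  \sum_l invmx (metric a p) k l *
    (pd a i (fun q => metric a q j l) p + pd a j (fun q => metric a q i l) p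
     - pd a l (fun q => metric a q i j) p) / 2.

Definition hess a h p : 'M[R]_n :=
  \matrix_(i, j) (pd a i (pd a j h) p -
                  \sum_k christoffel a k i j p * pd a k h p).

(* The component along d_l of R(d_i, d_j) d_k, with the sign convention
   R(U, V) W = nabla_U nabla_V W - nabla_V nabla_U W - nabla_[U, V] W. *)
Definition curv_comp a l k i j p : R :=
  pd a i (christoffel a l j k) p - pd a j (christoffel a l i k) p +
  \sum_m (christoffel a l i m p * christoffel a m j k p -
          christoffel a l j m p * christoffel a m i k p).

Definition curvature a p (U V W : 'rV[R]_n) : 'rV[R]_n :=
  \row_l \sum_i \sum_j \sum_k U 0 i * V 0 j * W 0 k * curv_comp a l k i j p.

Definition sectional a p (U V : 'rV[R]_n) : R :=
  inner a p (curvature a p U V V) U /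
  (inner a p U U * inner a p V V - inner a p U V ^+ 2).

(* Ric(V, W) = trace of U |-> R(U, V) W; positive on round spheres *)
Definition ricci a p : 'M[R]_n := \matrix_(j, k) \sum_i curv_comp a i k i j p.

Definition geodesic (c : R -> X) :=
  continuous c /\
  forall a t, dom a (c t) ->
    let x k := fun s : R => coord a (c s) 0 k in
    forall k,
      [/\ derivable (x k) t 1, derivable (derive1 (x k)) t 1 &
          derive1n 2 (x k) t +
          \sum_i \sum_j christoffel a k i j (c t) *
                        derive1 (x i) t * derive1 (x j) t = 0].

(* Every geodesic extends to the whole real line. *)
Definition complete_metric :=
  forall a p (v : 'rV[R]_n), dom a p ->
    exists c : R -> X, [/\ geodesic c, c 0 = p &
      forall i, derive1 (fun s : R => coord a (c s) 0 i) 0 = v 0 i].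

End Calculus.

Section Maps.
Variables (R : realType) (n m : nat).
Variables (X : chartedMetric R n) (Y : chartedMetric R m).
Implicit Types (a : chart X) (b : chart Y) (F : X -> Y) (p : X).

(* The differential of F; its i-th row is dF(d_i). *)
Definition dmap a b F p : 'M[R]_(n, m) :=
  \matrix_(i, j) pd a i (fun q => coord b (F q) 0 j) p.

Definition smooth_map F :=
  [/\ continuous F, (forall p, exists b, dom b (F p)) &
      forall a b j, smooth_in a (F @^-1` dom b) (fun p => coord b (F p) 0 j)].

(* F^* g_Y *)
Definition pullback a b F p : 'M[R]_n :=
  dmap a b F p *m metric b (F p) *m (dmap a b F p)^T.

(* trace nabla(dF) *)
Definition tension a b F p : 'rV[R]_m :=
  \row_c \sum_i \sum_j invmx (metric a p) i j *
    (pd a i (pd a j (fun q => coord b (F q) 0 c)) p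
     - \sum_k christoffel a k i j p * dmap a b F p k c
     + \sum_k \sum_l christoffel b c k l (F p) *
                     dmap a b F p i k * dmap a b F p j l).

Definition isometric_immersion F :=
  smooth_map F /\
  forall a b p, dom a p -> dom b (F p) ->
    row_free (dmap a b F p) /\ pullback a b F p = metric a p.

End Maps.

Section Manifolds.
Variables (R : realType) (n : nat).
Implicit Types X : chartedMetric R n.

(* Jacobian matrix at p of the change of coordinates from a to b *)
Definition jacobian X (a b : chart X) (p : X) : 'M[R]_n :=
  dmap a b (fun q : X => q) p.

Record is_riemannian X : Prop := IsRiemannian {
  manifold_hausdorff : hausdorff_space X;
  manifold_second_countable : @second_countable X;
  chart_cover : forall p : X, exists a : chart X, dom a p;
  chart_open : forall a : chart X, open (dom a);
  chart_image_open : forall a : chart X, open (coord a @` dom a);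
  chart_cancel : forall (a : chart X) p, dom a p -> param a (coord a p) = p;
  coord_continuous : forall (a : chart X) p, dom a p ->
    {for p, continuous (coord a)};
  param_continuous : forall (a : chart X) p, dom a p ->
    {for coord a p, continuous (param a)};
  transition_smooth : forall (a b : chart X) i,
    smooth_in a (dom b) (fun p => coord b p 0 i);
  metric_sym : forall (a : chart X) p, dom a p ->
    (metric a p)^T = metric a p;
  metric_pos : forall (a : chart X) p v, dom a p -> v != 0 ->
    0 < inner a p v v;
  metric_smooth : forall (a : chart X) i j,
    smooth_in a setT (fun p => metric a p i j);
  metric_compat : forall (a b : chart X) p, dom a p -> dom b p ->
    metric a p = jacobian a b p *m metric b p *m (jacobian a b p)^T }.

(* The orientation is the one for which all charts of the atlas are positive. *)
Definition oriented_atlas X :=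
  forall (a b : chart X) p, dom a p -> dom b p -> 0 < \det (jacobian a b p).

End Manifolds.

Record riemannianManifold (R : realType) (n : nat) := RiemannianManifold {
  manifold_data :> chartedMetric R n;
  manifold_laws : is_riemannian manifold_data }.

Section EinsteinType.
Variables (R : realType) (n m : nat).
Variables (Sigma : riemannianManifold R n) (N : riemannianManifold R m).

Record einstein_type (alpha : R) (h : Sigma -> R) (u : Sigma -> N) (mu lam : Sigma -> R)
    : Prop := EinsteinType {
  einstein_connected : connected [set: Sigma];
  einstein_complete : complete_metric Sigma;
  einstein_alpha : 0 < alpha;
  einstein_u : smooth_map u;
  einstein_h : smooth_fun h;
  einstein_mu : smooth_fun mu;
  einstein_lam : smooth_fun lam;
  einstein_ricci : forall (a : chart Sigma) (b : chart N) p,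
    dom a p -> dom b (u p) ->
    ricci a p - alpha *: pullback a b u p + hess a h p
      - mu p *: ((dfun a h p)^T *m dfun a h p) = lam p *: metric a p;
  einstein_tension : forall (a : chart Sigma) (b : chart N) p,
    dom a p -> dom b (u p) ->
    tension a b u p = grad a h p *m dmap a b u p }.

(* The equations Ric - alpha u^*g' = lam g and tau u = 0 then follow from
   [einstein_type]. *)
Definition einstein_harmonic (h : Sigma -> R) := exists c : R, forall p, h p = c.

End EinsteinType.

Section WarpedProduct.
Variables (R : realType) (n : nat) (I : set R) (f : R -> R).
Variable M : riemannianManifold R n.

(* I x_f M, as the open subset I x M of R x M: the union of the chart domains
   is I `*` setT, and a [smooth_map] into it takes its values there.  The
   coordinates are (t, x) with x a chart of M. *)
Definition warped : chartedMetric R (1 + n) :=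
  @ChartedMetric R (1 + n) (R * M)%type (chart M)
    (fun a => I `*` dom a)
    (fun a q => row_mx (q.1)%:M (coord a q.2))
    (fun a y => (lsubmx y 0 0, param a (rsubmx y)))
    (fun a q => block_mx 1%:M 0 0 (f q.1 ^+ 2 *: metric a q.2)).

Definition partial_t : 'rV[R]_(1 + n) := row_mx 1%:M 0.

End WarpedProduct.

Section Hypersurface.
Variables (R : realType) (n : nat).
Variables (Sigma : riemannianManifold R n) (Y : chartedMetric R (1 + n)).
Implicit Types (phi : Sigma -> Y) (a : chart Sigma) (b : chart Y) (p : Sigma).
(* nu b p is the component vector, in the chart b at phi p, of a vector field
   along phi. *)
Implicit Type nu : chart Y -> Sigma -> 'rV[R]_(1 + n).

Record unit_normal phi nu : Prop := UnitNormal {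
  normal_compat : forall b b' p, dom b (phi p) -> dom b' (phi p) ->
    nu b' p = nu b p *m jacobian b b' (phi p);
  normal_smooth : forall a b j,
    smooth_in a (phi @^-1` dom b) (fun p => nu b p 0 j);
  normal_unit : forall b p, dom b (phi p) ->
    inner b (phi p) (nu b p) (nu b p) = 1;
  normal_orth : forall a b p (v : 'rV[R]_n), dom a p -> dom b (phi p) ->
    inner b (phi p) (v *m dmap a b phi p) (nu b p) = 0 }.

(* The i-th row is the ambient covariant derivative of nu along dphi(d_i). *)
Definition cov_deriv phi nu a b p : 'M[R]_(n, 1 + n) :=
  \matrix_(i, c) (pd a i (fun q => nu b q 0 c) p +
    \sum_j \sum_k christoffel b c j k (phi p) * dmap a b phi p i j * nu b p 0 k).

(* dphi(A X) = - nabla_X nu *)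
Definition shape_operator phi nu (A : chart Sigma -> Sigma -> 'M[R]_n) :=
  forall a b p, dom a p -> dom b (phi p) ->
    A a p *m dmap a b phi p = - cov_deriv phi nu a b p.

End Hypersurface.

(* Main.v *)
(* Along the hypersurface, d_t = grad h + theta nu and the ambient derivative of d_t
   is X |-> (f'/f)(X - <X, d_t> d_t), so that
     Hess h = (f'/f) (g - dh (x) dh) + theta <A ., .>.
   As A (grad h) = rho grad h, the Gauss equation and k_M <= f'^2 - f f'' give
     Ric(grad h, grad h) <= (- (n-1) f''/f + n H rho - rho^2) |grad h|^2.
   The structure equation evaluated on grad h then yields
     (f'/f + mu) |grad h|^4 <= |grad h|^2 (- rho^2 + (n H + theta) rho
                                  + f'/f - (n-1) f''/f - lambda),
   and the hypotheses on Delta say that this quadratic polynomial in rho is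
   nonpositive.  Hence grad h = 0 at every point. *)

From HB Require Import structures.
Require Import Defs.
From mathcomp Require Import all_boot all_order all_algebra.
From mathcomp Require Import all_classical all_reals all_analysis.
From mathcomp Require Import ring lra.
Import Order.TTheory GRing.Theory Num.Theory.
Import numFieldNormedType.Exports.
(* Again, so that coord is the chart of Defs, not the coordinates of vector.v. *)
Import Defs.

Set Implicit Arguments.
Unset Strict Implicit.
Unset Printing Implicit Defensive.

Local Open Scope ring_scope.
Local Open Scope classical_set_scope.

(** * Calculus in several variables *)

(** The ambient [warped I f M] is bare chart data on R x M, not a [riemannianManifold], while the
    calculus in charts below rests on the manifold laws. Only its Christoffel symbols are computed
    in place. Otherwise the ambient metric and connection appear as matrix functions [wmetric] and
    [wconn] on the hypersurface, pulled back along (h, psi), where psi is the fiber component of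
    [phi]; the Gauss formula and equation are proved for abstract data of this kind. Directions have
    constant components in a chart, so brackets vanish and torsion-freeness becomes a symmetry
    between matrices. The bound on k_M enters through one identity: on a tangent plane the ambient
    curvature is a fiber term, f^2 times the excess of the fiber curvature over f'^2 - f f'', plus
    -f''/f times the Gram determinant. The hypothesis makes the fiber term nonpositive, and tracing
    the Gram determinants over a frame yields the factor n-1. In the last inequality the term alpha
    u^*g' is dropped because it is positive semidefinite. The coefficient n H + theta collects n H
    from the trace of the Gauss equation and theta from Hess h, and Delta is the discriminant of the
    resulting quadratic. *)

Section LineDerivative.
Variables (R : realType) (V : normedModType R).
Implicit Types (F : V -> R) (z v : V) (s t : R).

Lemma is_derive_line F z v t : derivable F (z + t *: v) v ->
  is_derive t 1 (fun s : R => F (z + s *: v)) ('D_v F (z + t *: v)).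
Proof.
have E : (fun k : R => k^-1 *: (((fun s : R => F (z + s *: v)) \o shift t) (k *: 1)
            - F (z + t *: v))) =
         (fun k : R => k^-1 *: ((F \o shift (z + t *: v)) (k *: v) - F (z + t *: v))).
  apply/funext => k /=; congr (_ *: (F _ - _)).
  by rewrite [k%:A]mulr1 scalerDl addrCA.
by move=> dF; split; rewrite /derivable /derive E.
Qed.

Lemma line_mvt F z v s :
  (forall t, `|t| <= `|s| -> derivable F (z + t *: v) v) ->
  exists2 c, `|c| <= `|s| & F (z + s *: v) - F z = s * 'D_v F (z + c *: v).
Proof.
move=> dF; set g := fun t : R => F (z + t *: v).
have g0 : F z = g 0 by rewrite /g scale0r addr0.
have dg (t : R) : `|t| <= `|s| -> is_derive t 1 g ('D_v F (z + t *: v)).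
  by move=> ts; apply: is_derive_line; apply: dF.
have cg (a b : R) : (forall t : R, t \in `[a, b]%R -> `|t| <= `|s|) ->
    {within `[a, b], continuous g}.
  move=> ab; apply: derivable_within_continuous => t tab.
  by have [] := dg t (ab t tab).
have [s0|s0] := lerP 0 s.
  have I (t : R) : t \in `[0, s]%R -> `|t| <= `|s|.
    by rewrite in_itv /= => /andP[t0 ts]; rewrite !ger0_norm.
  have [|c cs E] := MVT_segment (df := fun t => 'D_v F (z + t *: v)) s0 _ (cg _ _ I).
    by move=> t ts; apply/dg/I/subset_itv_oo_cc.
  by exists c; [exact: I|rewrite g0 E subr0 mulrC].
have I (t : R) : t \in `[s, 0]%R -> `|t| <= `|s|.
  by rewrite in_itv /= => /andP[t0 ts]; rewrite !ler0_norm // ?lerN2 // ltW.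
have [|c cs E] := MVT_segment (df := fun t => 'D_v F (z + t *: v)) (ltW s0) _ (cg _ _ I).
  by move=> t ts; apply/dg/I/subset_itv_oo_cc.
exists c; first exact: I.
by rewrite g0 -opprB E sub0r mulrN opprK mulrC.
Qed.

End LineDerivative.

Section PartialDerivatives.
Variables (R : realType) (n : nat).
Implicit Types (F : 'rV[R]_n -> R) (x y w : 'rV[R]_n) (i j : 'I_n).

Notation e i := (delta_mx 0 i : 'rV[R]_n).

Lemma row_norm_le w (c : R) : 0 <= c -> (forall i, `|w 0 i| <= c) -> `|w| <= c.
Proof.
move=> c0 wc; rewrite /Num.Def.normr/= mx_normrE bigmax_le// => -[i j] _ /=.
by rewrite ord1.
Qed.

Lemma row_norm_ge w i : `|w 0 i| <= `|w|.
Proof.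
rewrite [leRHS]/Num.Def.normr/= mx_normrE.
exact: (le_bigmax _ (fun ij => `|w ij.1 ij.2|) (0, i)).
Qed.

Let trunc (k : nat) w : 'rV[R]_n := \row_j (if (j < k)%N then w 0 j else 0).

Let truncS w i : trunc i.+1 w = trunc i w + w 0 i *: e i.
Proof.
apply/rowP => j; rewrite !mxE /= ltnS leq_eqVlt [_ == _ :> nat]val_eqE.
by have [->|ji] := eqVneq j i; rewrite ?ltnn ?mulr1 ?add0r ?mulr0 ?addr0.
Qed.

(* Move from x to x + w one coordinate at a time, by the mean value theorem. *)
Lemma increment_le F x w (r eps : R) : `|w| < r ->
  (forall y i, `|y - x| < r ->
     derivable F y (e i) /\ `|'D_(e i) F y - 'D_(e i) F x| <= eps) ->
  `|F (x + w) - F x - \sum_i w 0 i * 'D_(e i) F x| <= n%:R * (eps * `|w|).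
Proof.
move=> wr dF.
have E k : (k <= n)%N ->
    `|F (x + trunc k w) - F x - \sum_(i < n | (i < k)%N) w 0 i * 'D_(e i) F x|
    <= k%:R * (eps * `|w|).
  elim: k => [|k IH] kn.
    rewrite big_pred0 // mul0r subr0 (_ : trunc 0 w = 0) ?addr0 ?subrr ?normr0 //.
    by apply/rowP => j; rewrite !mxE.
  pose i := Ordinal kn; have {}IH := IH (ltnW kn).
  have -> : trunc k.+1 w = trunc k w + w 0 i *: e i by exact: (truncS w i).
  rewrite (bigD1 i) ?ltnSn //=.
  rewrite (eq_bigl (fun j : 'I_n => (j < k)%N)); last first.
    by move=> j; rewrite -val_eqE /= ltnS andbC -ltn_neqAle.
  (* The norm is the maximum of the coordinates, and no intermediate point differs from [x] by more
     than [|w|] in any coordinate. The whole path therefore stays in the ball where the partial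
     derivatives are controlled. *)
  have near_x t : `|t| <= `|w 0 i| -> `|x + trunc k w + t *: e i - x| < r.
    move=> tw; apply: le_lt_trans wr; rewrite addrC -addrA addKr.
    apply: row_norm_le => // j; rewrite !mxE /=.
    have [->|ji] := eqVneq j i; first by rewrite ltnn mulr1 add0r (le_trans tw) ?row_norm_ge.
    by rewrite mulr0 addr0; case: ifP => _; rewrite ?normr0 ?row_norm_ge.
  have [|c cw Ec] := @line_mvt _ _ F (x + trunc k w) (e i) (w 0 i).
    by move=> t /near_x/(dF _ i)[].
  move: IH; rewrite addrA; set S := \sum_(_ | _) _ => IH.
  have -> : F (x + trunc k w + w 0 i *: e i) - F x - (w 0 i * 'D_(e i) F x + S) =
     (F (x + trunc k w) - F x - S) +
     w 0 i * ('D_(e i) F (x + trunc k w + c *: e i) - 'D_(e i) F x).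
    by rewrite mulrBr -Ec; ring.
  rewrite -natr1 mulrDl mul1r; apply: le_trans (ler_normD _ _) _.
  apply: lerD => //; rewrite normrM mulrC ler_pM //; last exact: row_norm_ge.
  by have [] := dF _ i (near_x c cw).
have := E n (leqnn n); rewrite (eq_bigl predT) => [|i]; last by rewrite ltn_ord.
by rewrite (_ : trunc n w = w) //; apply/rowP => j; rewrite !mxE ltn_ord.
Qed.

(** Bridge from [smooth_in], which speaks only of partial derivatives, to total differentiability,
    on which the chain rule and linearity in the direction depend. The remainder estimate is
    [increment_le]. *)
Lemma differentiable_partials F x :
  (forall i, \forall y \near x, derivable F y (e i)) ->
  (forall i, {for x, continuous (fun y => 'D_(e i) F y)}) ->
  differentiable F x.
Proof.
move=> dF cF.
pose d w := \sum_i w 0 i * 'D_(e i) F x.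
have d_lin : linear d.
  move=> a w w'; rewrite /d scaler_sumr -big_split /=; apply: eq_bigr => i _.
  by rewrite !mxE mulrDl [in RHS]/GRing.scale /= mulrA.
pose dL : {linear _ -> _} := HB.pack d (GRing.isLinear.Build _ _ _ _ _ d_lin).
have d_cont : continuous d.
  move=> w; apply: differentiable_continuous.
  have -> : d = \sum_i (fun w => w 0 i * 'D_(e i) F x).
    by apply/funext => w'; rewrite fct_sumE.
  by apply: differentiable_sum => i; apply: differentiableM => //; exact: differentiable_coord.
have H : F \o shift x = cst (F x) + dL +o_ (0 : 'rV[R]_n) id.
  apply/eqaddoP => eps eps0.
  (* [increment_le] costs a factor n; dividing by n+1 absorbs it and also covers n = 0. *)
  pose eps' := eps / n.+1%:R.
  have eps'0 : 0 < eps' by rewrite divr_gt0.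
  have : \forall y \near x, forall i,
      derivable F y (e i) /\ `|'D_(e i) F y - 'D_(e i) F x| <= eps'.
    near=> y => i; split; move: i; near: y; apply: filter_forall => i; first exact: dF.
    have /cvgrPdist_le /(_ _ eps'0) := cF i.
    by apply: filterS => y; rewrite distrC.
  move=> /nbhs_ballP[r /= r0 rF]; apply: filterS (nbhs0_lt (V := 'rV[R]_n) r0) => w wr.
  rewrite /= !fctE opprD addrA (addrC w).
  apply: le_trans (increment_le (r := r) (eps := eps') _ _) _.
  - exact: wr.
  - by move=> y i yx; apply: rF; rewrite mx_norm_ball /ball_ /= distrC.
  - rewrite mulrA ler_wpM2r // /eps' mulrCA ler_piMr ?(ltW eps0) //.
    by rewrite ler_pdivrMr // mul1r ler_nat.
have dE : 'd F x = d :> (_ -> _).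
  by rewrite -[d]/(dL : _ -> _); apply: diff_unique.
by apply/diff_locallyP; rewrite dE.
Unshelve. all: by end_near. Qed.

Lemma derive_coord F x w : differentiable F x ->
  'D_w F x = \sum_i w 0 i * 'D_(e i) F x.
Proof.
move=> dF; rewrite deriveE // {1}[w]row_sum_delta linear_sum /=.
by apply: eq_bigr => i _; rewrite linearZ deriveE.
Qed.

(* The limit step of Schwarz's theorem: d1 = d2 is a second difference, written
   as a mixed derivative in the two possible orders. *)
Lemma eq_limit_quotients x (P1 P2 : 'rV[R]_n -> Prop) (D1 D2 : 'rV[R]_n -> R)
    (d1 d2 : R -> R) :
  (\forall y \near x, P1 y) -> (\forall y \near x, P2 y) ->
  {for x, continuous D1} -> {for x, continuous D2} ->
  (forall s r : R, 0 < s -> `|s| * 2 < r -> (forall y, `|y - x| < r -> P1 y) ->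
     exists2 y, `|y - x| < r & d1 s = s ^+ 2 * D1 y) ->
  (forall s r : R, 0 < s -> `|s| * 2 < r -> (forall y, `|y - x| < r -> P2 y) ->
     exists2 y, `|y - x| < r & d2 s = s ^+ 2 * D2 y) ->
  d1 =1 d2 -> D1 x = D2 x.
Proof.
move=> nP1 nP2 c1 c2 H1 H2 d12.
apply/eqP; rewrite -subr_eq0 -normr_eq0 eq_le normr_ge0 andbT.
apply/ler_addgt0Pl => eps eps0; rewrite addr0.
have eps2 : 0 < eps / 2 by rewrite divr_gt0.
move: c1 => /cvgrPdist_le /(_ _ eps2) c1.
move: c2 => /cvgrPdist_le /(_ _ eps2) c2.
have : nbhs x [set y | (P1 y /\ P2 y) /\
    (`|D1 x - D1 y| <= eps / 2 /\ `|D2 x - D2 y| <= eps / 2)].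
  exact: filterI (filterI nP1 nP2) (filterI c1 c2).
move=> /nbhs_ballP[r /= r0 rP].
have near_ball y : `|y - x| < r -> ball x r y.
  by rewrite mx_norm_ball /ball_ /= distrC.
have s0 : 0 < r / 4 by rewrite divr_gt0.
have sr : `|r / 4| * 2 < r by rewrite gtr0_norm //; lra.
have [y|y /near_ball/rP[_ [+ _]] E1] := H1 _ _ s0 sr.
  by move=> /near_ball/rP[[]].
have [z|z /near_ball/rP[_ [_ +]] E2] := H2 _ _ s0 sr.
  by move=> /near_ball/rP[[]].
have <- : D1 y = D2 z.
  by apply: (mulfI (expf_neq0 2 (lt0r_neq0 s0))); rewrite -E1 -E2.
rewrite distrC => zx yx; rewrite (splitr eps) -(subrKA (D1 y)).
by apply: le_trans (ler_normD _ _) _; rewrite lerD.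
Qed.

(** The second difference of F over a small square is symmetric in the two directions. The mean
    value theorem, applied along the first direction to the difference [G] and then along the second
    to the partial derivative, turns it into s^2 times a mixed derivative at a nearby point; either
    direction may come first. *)
Lemma schwarz F x i j :
  (\forall y \near x, derivable F y (e i)) ->
  (\forall y \near x, derivable F y (e j)) ->
  (\forall y \near x, derivable ('D_(e i) F) y (e j)) ->
  (\forall y \near x, derivable ('D_(e j) F) y (e i)) ->
  {for x, continuous ('D_(e j) ('D_(e i) F))} ->
  {for x, continuous ('D_(e i) ('D_(e j) F))} ->
  'D_(e j) ('D_(e i) F) x = 'D_(e i) ('D_(e j) F) x.
Proof.
move=> di dj dij dji cij cji.
have second_diff k l (s r : R) : 0 < s -> `|s| * 2 < r ->
    (forall y, `|y - x| < r -> derivable F y (e k) /\ derivable ('D_(e k) F) y (e l)) ->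
    exists2 y, `|y - x| < r &
      F (x + s *: e k + s *: e l) - F (x + s *: e l) - F (x + s *: e k) + F x
      = s ^+ 2 * 'D_(e l) ('D_(e k) F) y.
  move=> s0 sr dF.
  have near_x (t t' : R) : `|t| <= `|s| -> `|t'| <= `|s| ->
      `|x + t *: e k + t' *: e l - x| < r.
    move=> ts ts'; apply: le_lt_trans sr; rewrite addrC -addrA addKr.
    apply: row_norm_le => [|m]; first by rewrite mulr_ge0.
    rewrite !mxE eqxx /= (_ : `|s| * 2 = `|s| + `|s|); last by ring.
    apply: le_trans (ler_normD _ _) _.
    by apply: lerD; rewrite normrM; case: (m == _) => /=;
      rewrite ?normr1 ?normr0 ?mulr1 ?mulr0.
  pose G y := F (y + s *: e l) - F y.
  have dG (t : R) : `|t| <= `|s| ->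
      is_derive (x + t *: e k) (e k) G
       ('D_(e k) F (x + t *: e k + s *: e l) - 'D_(e k) F (x + t *: e k)).
    move=> ts.
    have -> : G = (fun y => F (y + s *: e l)) - F by apply/funext.
    have [d1 _] := dF _ (near_x t s ts (lexx _)).
    have := near_x t 0 ts; rewrite normr0 scale0r addr0 => /(_ (normr_ge0 _)) xt.
    have [d2 _] := dF _ xt.
    apply: is_deriveB; last by apply: derivableP.
    have E : (fun h : R => h^-1 *: (((fun y => F (y + s *: e l)) \o shift (x + t *: e k)) (h *: e k)
         - F (x + t *: e k + s *: e l))) =
       (fun h : R => h^-1 *: ((F \o shift (x + t *: e k + s *: e l)) (h *: e k)
         - F (x + t *: e k + s *: e l))).
      by apply/funext => h /=; rewrite [h *: _ + (_ + s *: _)]addrA.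
    by move: (derivableP d1) => [d1' _]; split; rewrite /derivable /derive E.
  have [t ts|c cs Ec] := @line_mvt _ _ G x (e k) s; first by have [] := dG t ts.
  have [t ts|c' cs' Ec'] := @line_mvt _ _ ('D_(e k) F) (x + c *: e k) (e l) s.
    by have [] := dF _ (near_x c t cs ts).
  exists (x + c *: e k + c' *: e l); first exact: near_x.
  have [_ dGc] := dG c cs; move: Ec; rewrite dGc Ec' mulrA -expr2 => <-.
  by rewrite /G; ring.
apply: (eq_limit_quotients (filterI di dij) (filterI dj dji) cij cji
  (second_diff i j) (second_diff j i)) => s.
by rewrite [x + s *: e j + _]addrAC; ring.
Unshelve. all: by end_near. Qed.

End PartialDerivatives.

Lemma near_eq_continuous (S T : topologicalType) (f g : S -> T) (x : S) :
  (\forall y \near x, f y = g y) -> {for x, continuous f} -> {for x, continuous g}.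
Proof.
move=> fg cf; rewrite /prop_for /continuous_at -(nbhs_singleton fg).
exact: cvg_trans (near_eq_cvg fg) cf.
Qed.

(** * Differentiation in charts *)

Section ChartCalculus.
Variables (R : realType) (n : nat) (X : riemannianManifold R n).
Implicit Types (a : chart X) (F G : X -> R) (p : X) (U : set X).

(** Total differentiability of the coordinate expression, rather than existence of the [pd a i F p]:
    this is the notion stable under composition. *)
Definition pdiff a F p := differentiable (F \o param a) (coord a p).

Lemma near_dom a p : dom a p -> \forall q \near p, dom a q.
Proof. by move=> ap; apply: open_nbhs_nbhs; split=> //; apply: chart_open (manifold_laws X) _. Qed.

Lemma near_param a p (P : X -> Prop) : dom a p ->
  (\forall q \near p, P q) -> \forall y \near coord a p, P (param a y).
Proof.
move=> ap Pp; have := param_continuous (manifold_laws X) ap.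
by rewrite /prop_for /continuous_at (chart_cancel (manifold_laws X) ap); apply.
Qed.

Lemma near_coord a p (P : 'rV[R]_n -> Prop) : dom a p ->
  (\forall y \near coord a p, P y) -> \forall q \near p, P (coord a q).
Proof. by move=> ap Py; apply: (coord_continuous (manifold_laws X) ap). Qed.

(** The laws only give [param] after [coord]. The other composite is the identity on the image of
    the chart, which is a neighbourhood of [coord a p] because it is open. *)
Lemma near_coordK a p : dom a p ->
  \forall y \near coord a p, coord a (param a y) = y.
Proof.
move=> ap; have : nbhs (coord a p) (coord a @` dom a).
  by apply: open_nbhs_nbhs; split; [apply: chart_image_open (manifold_laws X) _|exists p].
by apply: filterS => _ [q aq <-]; rewrite (chart_cancel (manifold_laws X) aq).
Qed.

Lemma pd_param a i F p : dom a p ->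
  \forall y \near coord a p, 'D_(delta_mx 0 i) (F \o param a) y = pd a i F (param a y).
Proof. by move=> /near_coordK; apply: filterS => y ya; rewrite /pd ya. Qed.

Lemma smooth_pdiff a U F s p : open U -> smooth_in a U F -> dom a p -> U p ->
  pdiff a (iter_pd a s F) p.
Proof.
move=> oU sF ap Up; have aUp : \forall q \near p, dom a q /\ U q.
  by near=> q; split; near: q; [apply: near_dom|apply: open_nbhs_nbhs].
have := near_param ap aUp => aUy; apply: differentiable_partials => i.
  near=> y; have ya : coord a (param a y) = y by near: y; apply: near_coordK.
  have [ay Uy] : dom a (param a y) /\ U (param a y) by near: y.
  by have [_ /(_ i)] := sF s _ ay Uy; rewrite ya.
have pa := chart_cancel (manifold_laws X) ap.
have [ci _] := sF (i :: s) p ap Up.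
apply: (@near_eq_continuous _ _ (iter_pd a (i :: s) F \o param a)).
  by apply: filterS (pd_param i (iter_pd a s F) ap) => y Ey; symmetry; exact: Ey.
apply: continuous_comp; first exact: param_continuous (manifold_laws X) _ _ ap.
by rewrite pa.
Unshelve. all: by end_near. Qed.

(** An iterated [pd] returns to the manifold between the two derivatives; by [pd_param] this agrees,
    near [coord a p], with an iterated derivative in the coordinates, to which [schwarz] applies. *)
Lemma pdC a U F i j p : open U -> smooth_in a U F -> dom a p -> U p ->
  pd a i (pd a j F) p = pd a j (pd a i F) p.
Proof.
move=> oU sF ap Up; have aUp : \forall q \near p, dom a q /\ U q.
  by near=> q; split; near: q; [apply: near_dom|apply: open_nbhs_nbhs].
have K k l : pd a k (pd a l F) p = 'D_(delta_mx 0 k) ('D_(delta_mx 0 l) (F \o param a)) (coord a p).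
  apply: near_eq_derive; apply: filterS (pd_param l F ap) => y Ey.
  by symmetry; exact: Ey.
have D k s : \forall y \near coord a p, derivable (iter_pd a s F \o param a) y (delta_mx 0 k).
  near=> y; have ya : coord a (param a y) = y by near: y; apply: near_coordK.
  have [ay Uy] : dom a (param a y) /\ U (param a y) by near: y; apply: near_param aUp.
  by have [_ /(_ k)] := sF s _ ay Uy; rewrite ya.
have DD k l : \forall y \near coord a p,
    derivable ('D_(delta_mx 0 l) (F \o param a)) y (delta_mx 0 k).
  near=> y; have Dy : derivable (iter_pd a [:: l] F \o param a) y (delta_mx 0 k).
    by near: y; apply: D.
  apply: near_eq_derivable Dy.
  have : \forall z \near y, 'D_(delta_mx 0 l) (F \o param a) z = pd a l F (param a z).
    by near: y; exact: near_join (pd_param l F ap).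
  by apply: filterS => z Ez; symmetry; exact: Ez.
have C k l : {for coord a p, continuous
    ('D_(delta_mx 0 k) ('D_(delta_mx 0 l) (F \o param a)))}.
  have := differentiable_continuous (smooth_pdiff [:: k; l] oU sF ap Up).
  apply: near_eq_continuous; near=> y.
  have Ek : 'D_(delta_mx 0 k) (pd a l F \o param a) y = pd a k (pd a l F) (param a y).
    by near: y; apply: pd_param.
  rewrite [LHS]/= -Ek; apply: near_eq_derive.
  have : \forall z \near y, 'D_(delta_mx 0 l) (F \o param a) z = pd a l F (param a z).
    by near: y; exact: near_join (pd_param l F ap).
  by apply: filterS => z Ez; symmetry; exact: Ez.
rewrite !K; apply: schwarz; [exact: (D _ [::])|exact: (D _ [::])|
  exact: DD|exact: DD|exact: C|exact: C].
Unshelve. all: by end_near. Qed.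

End ChartCalculus.

Section PdAlgebra.
Variables (R : realType) (n : nat) (X : riemannianManifold R n).
Implicit Types (a : chart X) (F G : X -> R) (p : X) (v : 'rV[R]_n).

(* The derivative along the vector field with constant components v in the chart
   a; such fields commute, so no bracket terms appear below. *)
Definition dd a (v : 'rV[R]_n) F p : R := 'D_v (F \o param a) (coord a p).

Lemma pdE a i F p : pd a i F p = dd a (delta_mx 0 i) F p.
Proof. by []. Qed.

Lemma dd_near a v F G p : dom a p -> (\forall q \near p, F q = G q) ->
  dd a v F p = dd a v G p.
Proof. by move=> ap FG; apply: near_eq_derive; apply: near_param FG. Qed.

Lemma dd_coord a v F p : pdiff a F p -> dd a v F p = \sum_i v 0 i * pd a i F p.
Proof. exact: derive_coord. Qed.

(** Identities between component functions hold on a chart domain only, so differentiability has to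
    pass between functions that agree near [p]: [G] inherits the first-order expansion of [F]. *)
Lemma pdiff_near a F G p : dom a p -> (\forall q \near p, F q = G q) ->
  pdiff a F p -> pdiff a G p.
Proof.
move=> ap FG dF; have := near_param ap FG => FGa.
have dFx : F \o param a \o shift (coord a p) =
    cst ((F \o param a) (coord a p)) + 'd (F \o param a) (coord a p) +o_ (0 : 'rV[R]_n) id.
  exact: diff_locally.
have H : G \o param a \o shift (coord a p) =
    cst ((G \o param a) (coord a p)) + 'd (F \o param a) (coord a p) +o_ (0 : 'rV[R]_n) id.
  apply/eqaddoP => e e0; move/eqaddoP: dFx => /(_ e e0).
  have : \forall w \near (0 : 'rV[R]_n), F (param a (w + coord a p)) = G (param a (w + coord a p)).
    move: FGa; rewrite (near_shift 0) /= subr0 => FGa.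
    by apply: filterS FGa => w; rewrite /= .
  apply: filterS2 => w FGw; rewrite /= !fctE /= FGw.
  by rewrite -(nbhs_singleton FGa).
have dE := diff_unique (diff_continuous dF) H.
by apply/diff_locallyP; rewrite dE; split=> //; exact: diff_continuous.
Qed.

Lemma pdiff_cst a (c : R) p : pdiff a (fun=> c) p.
Proof. exact: (@differentiable_cst _ 'rV[R]_n R c). Qed.

Lemma pdiffD a F G p : pdiff a F p -> pdiff a G p -> pdiff a (fun q => F q + G q) p.
Proof. exact: differentiableD. Qed.

Lemma pdiffN a F p : pdiff a F p -> pdiff a (fun q => - F q) p.
Proof. exact: differentiableN. Qed.

Lemma pdiffM a F G p : pdiff a F p -> pdiff a G p -> pdiff a (fun q => F q * G q) p.
Proof. exact: differentiableM. Qed.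

Lemma pdiffV a F p : F p != 0 -> dom a p -> pdiff a F p -> pdiff a (fun q => (F q)^-1) p.
Proof.
move=> Fp ap dF; apply: (@differentiableV _ _ (F \o param a)) => //.
by rewrite /= (chart_cancel (manifold_laws X) ap).
Qed.

Lemma pdiff_sum a (I : Type) (r : seq I) (P : pred I) (F : I -> X -> R) p :
  (forall i, pdiff a (F i) p) -> pdiff a (fun q => \sum_(i <- r | P i) F i q) p.
Proof.
move=> dF; elim: r => [|i r IH].
  by under [X in pdiff a X p]eq_fun do rewrite big_nil; exact: pdiff_cst.
under [X in pdiff a X p]eq_fun do rewrite big_cons; case: (P i) => //.
exact: pdiffD.
Qed.

Lemma pdiff_prod a (I : Type) (r : seq I) (P : pred I) (F : I -> X -> R) p :
  (forall i, pdiff a (F i) p) -> pdiff a (fun q => \prod_(i <- r | P i) F i q) p.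
Proof.
move=> dF; elim: r => [|i r IH].
  by under [X in pdiff a X p]eq_fun do rewrite big_nil; exact: pdiff_cst.
under [X in pdiff a X p]eq_fun do rewrite big_cons; case: (P i) => //.
exact: pdiffM.
Qed.

Lemma dd_cst a v (c : R) p : dd a v (fun=> c) p = 0.
Proof. exact: derive_cst. Qed.

Lemma ddD a v F G p : pdiff a F p -> pdiff a G p ->
  dd a v (fun q => F q + G q) p = dd a v F p + dd a v G p.
Proof. by move=> dF dG; rewrite /dd -deriveD //; exact: diff_derivable. Qed.

Lemma ddN a v F p : pdiff a F p -> dd a v (fun q => - F q) p = - dd a v F p.
Proof. by move=> dF; rewrite /dd -deriveN //; exact: diff_derivable. Qed.

Lemma ddM a v F G p : dom a p -> pdiff a F p -> pdiff a G p ->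
  dd a v (fun q => F q * G q) p = dd a v F p * G p + F p * dd a v G p.
Proof.
move=> ap dF dG; have := @deriveM _ _ (F \o param a) (G \o param a) (coord a p)
  v (diff_derivable dF) (diff_derivable dG).
rewrite /dd /= (chart_cancel (manifold_laws X) ap) => ->.
by rewrite addrC [G p *: _]mulrC.
Qed.

Lemma dd_sum a v m (F : 'I_m -> X -> R) p : (forall k, pdiff a (F k) p) ->
  dd a v (fun q => \sum_k F k q) p = \sum_k dd a v (F k) p.
Proof.
move=> dF; elim: m F dF => [|m IH] F dF.
  rewrite big_ord0 (_ : (fun q => _) = fun=> 0) ?dd_cst //.
  by apply/funext => q; rewrite big_ord0.
under [X in dd a v X p]eq_fun do rewrite big_ord_recl.
by rewrite ddD ?IH ?big_ord_recl //; exact: pdiff_sum.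
Qed.

Lemma dd_comp_real a v (f : R -> R) F p : dom a p -> derivable f (F p) 1 -> pdiff a F p ->
  dd a v (fun q => f (F q)) p = derive1 f (F p) * dd a v F p.
Proof.
move=> ap /derivable1_diffP df dF.
have pa := chart_cancel (manifold_laws X) ap.
have df' : differentiable f ((F \o param a) (coord a p)) by rewrite /= pa.
rewrite /dd -/(f \o (F \o param a)) deriveE; last exact: differentiable_comp.
by rewrite diff_comp //= diff1E // /= pa -deriveE // mulrC.
Qed.

Lemma pdiff_comp_real a (f : R -> R) F p : dom a p -> derivable f (F p) 1 -> pdiff a F p ->
  pdiff a (fun q => f (F q)) p.
Proof.
move=> ap /derivable1_diffP df dF; apply: (@differentiable_comp _ _ _ _ (F \o param a) f) => //.
by rewrite /= (chart_cancel (manifold_laws X) ap).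
Qed.

Section Chain.
Variables (m : nat) (Y : riemannianManifold R m) (psi : X -> Y).
Variables (a : chart X) (b : chart Y) (p : X).
Hypotheses (ap : dom a p) (bp : dom b (psi p)) (psi_cont : {for p, continuous psi}).
Hypothesis dpsi : forall k, pdiff a (fun q => coord b (psi q) 0 k) p.
Variables (G : Y -> R) (dG : pdiff b G (psi p)).

Let Psi : 'rV[R]_n -> 'rV[R]_m := coord b \o psi \o param a.

Let psi_near : \forall q \near p, (G \o param b) (coord b (psi q)) = G (psi q).
Proof.
have : \forall q \near p, dom b (psi q) by exact: psi_cont (near_dom bp).
by apply: filterS => q bq /=; rewrite (chart_cancel (manifold_laws Y) bq).
Qed.

Let diff_Psi : differentiable Psi (coord a p).
Proof.
have -> : Psi = \sum_k (fun y => (coord b (psi (param a y)) 0 k) *: delta_mx 0 k).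
  by apply/funext => y; rewrite fct_sumE [LHS]row_sum_delta.
apply: (@differentiable_sum _ _ _ _
  (fun k y => (coord b (psi (param a y)) 0 k) *: delta_mx 0 k)) => k.
have H := differentiableZl (delta_mx 0 k : 'rV[R]_m) (dpsi k). exact H.
Qed.

Let dG' : differentiable (G \o param b) (Psi (coord a p)).
Proof. by rewrite /Psi /= (chart_cancel (manifold_laws X) ap). Qed.

Lemma pdiff_comp : pdiff a (G \o psi) p.
Proof.
apply: (pdiff_near ap psi_near).
exact: (differentiable_comp diff_Psi dG').
Qed.

(** [G \o psi] is replaced by its factorization through the coordinates of [b], with which it agrees
    only near [p], where [psi] stays in [dom b]. *)
Lemma dd_comp v : dd a v (G \o psi) p =
  \sum_k dd a v (fun q => coord b (psi q) 0 k) p * pd b k G (psi p).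
Proof.
have pa := chart_cancel (manifold_laws X) ap.
rewrite -(dd_near v ap psi_near).
rewrite /dd -/((G \o param b) \o Psi) deriveE; last exact: differentiable_comp.
rewrite diff_comp // [LHS]/= -!deriveE // [LHS]derive_coord //.
rewrite pa; apply: eq_bigr => k _; congr (_ * _).
by rewrite derive_mx ?mxE //; exact: (diff_derivable diff_Psi).
Qed.

End Chain.
End PdAlgebra.

(** * Differentiation of matrix-valued functions *)

Section MatrixCalculus.
Variables (R : realType) (n : nat) (X : riemannianManifold R n).
Variables (a : chart X) (p : X) (ap : dom a p).
Implicit Types (v : 'rV[R]_n).

Definition mdiff m k (W : X -> 'M[R]_(m, k)) :=
  forall i j, pdiff a (fun q => W q i j) p.

Definition dm v m k (W : X -> 'M[R]_(m, k)) : 'M[R]_(m, k) :=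
  \matrix_(i, j) dd a v (fun q => W q i j) p.

Lemma dmE v m k (W : X -> 'M[R]_(m, k)) i j :
  dm v W i j = dd a v (fun q => W q i j) p.
Proof. by rewrite mxE. Qed.

Lemma mdiff_near m k (W Z : X -> 'M[R]_(m, k)) :
  (\forall q \near p, W q = Z q) -> mdiff W -> mdiff Z.
Proof.
move=> WZ dW i j; apply: pdiff_near ap _ (dW i j).
by apply: filterS WZ => q ->.
Qed.

Lemma dm_near v m k (W Z : X -> 'M[R]_(m, k)) :
  (\forall q \near p, W q = Z q) -> dm v W = dm v Z.
Proof.
move=> WZ; apply/matrixP => i j; rewrite !mxE; apply: dd_near => //.
by apply: filterS WZ => q ->.
Qed.

Lemma mdiff_cst m k (W : 'M[R]_(m, k)) : mdiff (fun=> W).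
Proof. by move=> i j; apply: pdiff_cst. Qed.

Lemma mdiffD m k (W Z : X -> 'M[R]_(m, k)) : mdiff W -> mdiff Z ->
  mdiff (fun q => W q + Z q).
Proof.
move=> dW dZ i j; under [X in pdiff a X p]eq_fun do rewrite mxE.
exact: pdiffD.
Qed.

Lemma mdiffZ m k (F : X -> R) (W : X -> 'M[R]_(m, k)) : pdiff a F p -> mdiff W ->
  mdiff (fun q => F q *: W q).
Proof.
move=> dF dW i j; under [X in pdiff a X p]eq_fun do rewrite mxE.
exact: pdiffM.
Qed.

Lemma mdiffM m k l (W : X -> 'M[R]_(m, k)) (Z : X -> 'M[R]_(k, l)) :
  mdiff W -> mdiff Z -> mdiff (fun q => W q *m Z q).
Proof.
move=> dW dZ i j; under [X in pdiff a X p]eq_fun do rewrite mxE.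
by apply: pdiff_sum => s; apply: pdiffM.
Qed.

Lemma mdiff_tr m k (W : X -> 'M[R]_(m, k)) : mdiff W -> mdiff (fun q => (W q)^T).
Proof.
by move=> dW i j; under [X in pdiff a X p]eq_fun do rewrite mxE; apply: dW.
Qed.

Lemma mdiff_scalar m (F : X -> R) : pdiff a F p -> mdiff (fun q => (F q)%:M : 'M[R]_m).
Proof.
move=> dF i j; under [X in pdiff a X p]eq_fun do rewrite mxE.
by case: (i == j) => //=; apply: pdiff_cst.
Qed.

Lemma mdiff_block m1 m2 k1 k2 (Wul : X -> 'M[R]_(m1, k1)) (Wur : X -> 'M[R]_(m1, k2))
    (Wdl : X -> 'M[R]_(m2, k1)) (Wdr : X -> 'M[R]_(m2, k2)) :
  mdiff Wul -> mdiff Wur -> mdiff Wdl -> mdiff Wdr ->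
  mdiff (fun q => block_mx (Wul q) (Wur q) (Wdl q) (Wdr q)).
Proof.
move=> d1 d2 d3 d4 i j.
by case: (split_ordP i) => i' ->; case: (split_ordP j) => j' ->;
  [under [X in pdiff a X p]eq_fun do rewrite block_mxEul
  |under [X in pdiff a X p]eq_fun do rewrite block_mxEur
  |under [X in pdiff a X p]eq_fun do rewrite block_mxEdl
  |under [X in pdiff a X p]eq_fun do rewrite block_mxEdr].
Qed.

Lemma pdiff_det m (W : X -> 'M[R]_m) : mdiff W -> pdiff a (fun q => \det (W q)) p.
Proof.
move=> dW; apply: pdiff_sum => s; apply: pdiffM; first exact: pdiff_cst.
by apply: pdiff_prod => i.
Qed.

(** Cramer's rule: the inverse is a rational expression in the entries. Since [invmx] follows this
    formula only at invertible matrices, the equality is a local one. *)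
Lemma mdiff_inv m (W : X -> 'M[R]_m) : (\forall q \near p, W q \in unitmx) ->
  mdiff W -> mdiff (fun q => invmx (W q)).
Proof.
move=> uW dW; have E : \forall q \near p, (\det (W q))^-1 *: \adj (W q) = invmx (W q).
  by apply: filterS uW => q Wq; rewrite /invmx Wq.
apply: mdiff_near E _; apply: mdiffZ.
  apply: pdiffV => //; last exact: pdiff_det.
  by have := nbhs_singleton uW; rewrite unitmxE unitfE.
move=> i j; under [X in pdiff a X p]eq_fun do rewrite mxE.
apply: pdiffM; first exact: pdiff_cst.
apply: pdiff_det => k l; under [X in pdiff a X p]eq_fun do rewrite !mxE.
exact: dW.
Qed.

Lemma dm_cst v m k (W : 'M[R]_(m, k)) : dm v (fun=> W) = 0.
Proof. by apply/matrixP => i j; rewrite !mxE dd_cst. Qed.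

Lemma dmD v m k (W Z : X -> 'M[R]_(m, k)) : mdiff W -> mdiff Z ->
  dm v (fun q => W q + Z q) = dm v W + dm v Z.
Proof.
move=> dW dZ; apply/matrixP => i j; rewrite !mxE -ddD //.
by under [X in dd a v X p]eq_fun do rewrite mxE.
Qed.

Lemma dmZ v m k (F : X -> R) (W : X -> 'M[R]_(m, k)) : pdiff a F p -> mdiff W ->
  dm v (fun q => F q *: W q) = dd a v F p *: W p + F p *: dm v W.
Proof.
move=> dF dW; apply/matrixP => i j; rewrite !mxE -ddM //.
by under [X in dd a v X p]eq_fun do rewrite mxE.
Qed.

Lemma dmM v m k l (W : X -> 'M[R]_(m, k)) (Z : X -> 'M[R]_(k, l)) :
  mdiff W -> mdiff Z -> dm v (fun q => W q *m Z q) = dm v W *m Z p + W p *m dm v Z.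
Proof.
move=> dW dZ; apply/matrixP => i j; rewrite !mxE.
under [X in dd a v X p]eq_fun do rewrite mxE.
rewrite dd_sum => [|s]; last exact: pdiffM.
by rewrite -big_split; apply: eq_bigr => s _; rewrite !mxE ddM.
Qed.

Lemma dm_mull v m k l (W : 'M[R]_(m, k)) (Z : X -> 'M[R]_(k, l)) :
  mdiff Z -> dm v (fun q => W *m Z q) = W *m dm v Z.
Proof. by move=> dZ; rewrite (dmM v (mdiff_cst W) dZ) dm_cst mul0mx add0r. Qed.

Lemma dm_tr v m k (W : X -> 'M[R]_(m, k)) : dm v (fun q => (W q)^T) = (dm v W)^T.
Proof.
apply/matrixP => i j; rewrite !mxE.
by under [X in dd a v X p]eq_fun do rewrite mxE.
Qed.

Lemma dm_scalar v m (F : X -> R) : dm v (fun q => (F q)%:M : 'M[R]_m) = (dd a v F p)%:M.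
Proof.
apply/matrixP => i j; rewrite !mxE; under [X in dd a v X p]eq_fun do rewrite mxE.
by case: (i == j) => //=; rewrite dd_cst.
Qed.

Lemma dm_block v m1 m2 k1 k2 (Wul : X -> 'M[R]_(m1, k1)) (Wur : X -> 'M[R]_(m1, k2))
    (Wdl : X -> 'M[R]_(m2, k1)) (Wdr : X -> 'M[R]_(m2, k2)) :
  dm v (fun q => block_mx (Wul q) (Wur q) (Wdl q) (Wdr q)) =
  block_mx (dm v Wul) (dm v Wur) (dm v Wdl) (dm v Wdr).
Proof.
apply/matrixP => i j; rewrite mxE.
by case: (split_ordP i) => i' ->; case: (split_ordP j) => j' ->;
  [rewrite block_mxEul; under [X in dd a v X p]eq_fun do rewrite block_mxEul
  |rewrite block_mxEur; under [X in dd a v X p]eq_fun do rewrite block_mxEur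
  |rewrite block_mxEdl; under [X in dd a v X p]eq_fun do rewrite block_mxEdl
  |rewrite block_mxEdr; under [X in dd a v X p]eq_fun do rewrite block_mxEdr]; rewrite mxE.
Qed.

End MatrixCalculus.

(** * The Levi-Civita connection and its curvature *)

(* The algebra behind the uniqueness of the Levi-Civita connection. *)
Lemma sym_antisym_eq0 (R : realType) (n : nat) (K : 'I_n -> 'M[R]_n) :
  (forall i j l, K i j l = K j i l) -> (forall i j l, K i j l = - K i l j) ->
  forall i, K i = 0.
Proof.
move=> Ks Ka i; apply/matrixP => j l; rewrite mxE.
(* Alternating the two transpositions three times each returns to the same indices, with three
   changes of sign. *)
suff : K i j l = - K i j l by lra.
by rewrite {1}Ka Ks Ka Ks opprK Ka Ks.
Qed.

Section Christoffel.
Variables (R : realType) (n : nat) (X : chartedMetric R n) (a : chart X) (p : X).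

Definition dmetric i : 'M[R]_n := \matrix_(j, l) pd a i (fun q => metric a q j l) p.

(** Row j holds the components of nabla_(d_i) d_j, so that the connection acts on row vectors from
    the right. *)
Definition christoffel_mx i : 'M[R]_n := \matrix_(j, k) christoffel a k i j p.

Hypothesis metric_unit : metric a p \in unitmx.
Hypothesis metricT : (metric a p)^T = metric a p.
Hypothesis dmetricT : forall i, (dmetric i)^T = dmetric i.

(** Christoffel symbols of the first kind, with the upper index lowered by the metric. *)
Let T i : 'M[R]_n := \matrix_(j, l) ((dmetric i j l + dmetric j i l - dmetric l i j) / 2).

Let christoffel_lower i : christoffel_mx i *m metric a p = T i.
Proof.
suff -> : christoffel_mx i = T i *m invmx (metric a p) by rewrite mulmxKV.
apply/matrixP => j k; rewrite !mxE; apply: eq_bigr => l _.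
have gT : invmx (metric a p) l k = invmx (metric a p) k l.
  by rewrite -[in LHS]metricT -trmx_inv mxE.
by rewrite !mxE -mulrA mulrC gT.
Qed.

Lemma christoffel_compat i :
  christoffel_mx i *m metric a p + metric a p *m (christoffel_mx i)^T = dmetric i.
Proof.
have -> : metric a p *m (christoffel_mx i)^T = (T i)^T.
  by rewrite -christoffel_lower trmx_mul metricT.
rewrite christoffel_lower /T; move: dmetric dmetricT => D DT.
have DE i' j' l' : D i' l' j' = D i' j' l' by rewrite -[in LHS]DT mxE.
apply/matrixP => j l; rewrite !mxE (DE i j l); lra.
Qed.

Lemma christoffel_sym i j k : christoffel_mx i j k = christoffel_mx j i k.
Proof.
have E i' : christoffel_mx i' = T i' *m invmx (metric a p).
  by rewrite -christoffel_lower mulmxK.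
rewrite !E !mxE; apply: eq_bigr => l _; congr (_ * _).
rewrite /T; move: dmetric dmetricT => D DT; rewrite !mxE.
by rewrite -[in D l i j]DT mxE [D i j l + _]addrC.
Qed.

(** Allows a connection to be recognized from metric compatibility and symmetry, without evaluating
    the Christoffel formula. After lowering an index, the difference of two candidates is symmetric
    in its first two indices and antisymmetric in its last two. *)
Lemma christoffel_unique (W : 'I_n -> 'M[R]_n) :
  (forall i, W i *m metric a p + metric a p *m (W i)^T = dmetric i) ->
  (forall i j k, W i j k = W j i k) -> forall i, christoffel_mx i = W i.
Proof.
move=> Wc Ws i; apply/eqP; rewrite -subr_eq0; apply/eqP.
pose K i := (christoffel_mx i - W i) *m metric a p.
suff : K i = 0 by move=> /(congr1 (mulmx^~ (invmx (metric a p)))); rewrite mulmxK // mul0mx.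
apply: sym_antisym_eq0 => {}i j l.
  rewrite !mxE; apply: eq_bigr => k _; congr (_ * _).
  have := christoffel_sym i j k; move: christoffel_mx => L LE.
  by rewrite !mxE LE Ws.
have : K i + (K i)^T = 0.
  rewrite /K trmx_mul metricT raddfB /= mulmxBl mulmxBr addrACA -opprD Wc.
  by rewrite christoffel_compat subrr.
move=> /(congr1 (fun W : 'M[R]_n => W j l)); move: (K i) => Ki.
by rewrite !mxE => /eqP; rewrite addr_eq0 => /eqP.
Qed.

End Christoffel.

Section RiemannianConnection.
Variables (R : realType) (n : nat) (X : riemannianManifold R n) (a : chart X) (p : X).
Hypothesis ap : dom a p.
Implicit Type v w : 'rV[R]_n.

Lemma metric_mdiff : mdiff a p (metric a).
Proof.
move=> i j.
exact: (smooth_pdiff [::] openT (@metric_smooth _ _ _ (manifold_laws X) a i j) ap).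
Qed.

Lemma dmetric_sym k : (dmetric a p k)^T = dmetric a p k.
Proof.
apply/matrixP => i j; rewrite !mxE !pdE; apply: dd_near => //.
apply: filterS (near_dom ap) => q aq.
by rewrite -[in LHS](metric_sym (manifold_laws X) aq) mxE.
Qed.

Lemma inner_ge0 v : 0 <= inner a p v v.
Proof.
have [->|v0] := eqVneq v 0; first by rewrite /inner !mul0mx mxE.
exact/ltW/(metric_pos (manifold_laws X)).
Qed.

Lemma metric_unitmx : metric a p \in unitmx.
Proof.
rewrite -row_free_unit -kermx_eq0; apply/rowV0P => v /sub_kermxP vg.
apply/eqP/contraT => v0; have := metric_pos (manifold_laws X) ap v0.
by rewrite /inner vg mul0mx mxE ltxx.
Qed.

End RiemannianConnection.

Section ConnectionMatrix.
Variables (R : realType) (n : nat) (X : riemannianManifold R n) (a : chart X).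
Implicit Types (v w : 'rV[R]_n) (p : X).

(* The i-th row is nabla_v d_i. *)
Definition conn p v : 'M[R]_n := \sum_i v 0 i *: christoffel_mx a p i.

Lemma christoffel_mxC p i j k : dom a p -> christoffel_mx a p i j k = christoffel_mx a p j i k.
Proof.
move=> ap; apply: christoffel_sym; [exact: metric_unitmx|exact: metric_sym (manifold_laws X) _ _ ap|].
by move=> l; apply: dmetric_sym.
Qed.

(** Torsion-freeness: for fields with constant components, [w *m conn p v] is nabla_v w, and such
    fields commute. *)
Lemma conn_sym p v w : dom a p -> w *m conn p v = v *m conn p w.
Proof.
move=> ap; apply/rowP => k; rewrite !mxE.
under eq_bigr do rewrite summxE mulr_sumr.
under [RHS]eq_bigr do rewrite summxE mulr_sumr.
rewrite exchange_big; apply: eq_bigr => i _; apply: eq_bigr => j _.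
have := christoffel_mxC i j k ap; move: christoffel_mx => L LE.
by rewrite !mxE LE mulrCA.
Qed.

Lemma dm_metric p v : dom a p -> dm a p v (metric a) = \sum_i v 0 i *: dmetric a p i.
Proof.
move=> ap; apply/matrixP => j k; rewrite mxE dd_coord; last exact: metric_mdiff.
by rewrite summxE; apply: eq_bigr => i _; rewrite !mxE.
Qed.

Lemma conn_compat p v : dom a p ->
  conn p v *m metric a p + metric a p *m (conn p v)^T = dm a p v (metric a).
Proof.
move=> ap; rewrite dm_metric // /conn mulmx_suml raddf_sum /= mulmx_sumr -big_split /=.
apply: eq_bigr => i _; rewrite linearZ /= -scalemxAl -scalemxAr -scalerDr.
rewrite christoffel_compat //; [exact: metric_unitmx|exact: metric_sym (manifold_laws X) _ _ ap|].
by move=> l; apply: dmetric_sym.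
Qed.

Lemma christoffel_mdiff p k : dom a p -> mdiff a p (fun q => christoffel_mx a q k).
Proof.
move=> ap i j; under [F in pdiff a F p]eq_fun do rewrite mxE.
apply: pdiff_sum => l.
have dS s t r : pdiff a (pd a s (fun q => metric a q t r)) p.
  exact: (smooth_pdiff [:: s] openT (@metric_smooth _ _ _ (manifold_laws X) a t r) ap).
apply: pdiffM; last exact: pdiff_cst.
apply: pdiffM; last by apply: pdiffD; [apply: pdiffD|apply: pdiffN]; exact: dS.
have uW : \forall q \near p, metric a q \in unitmx.
  by apply: filterS (near_dom ap) => q; exact: metric_unitmx.
exact: (mdiff_inv ap uW (metric_mdiff ap)).
Qed.

Lemma conn_mdiff p v : dom a p -> mdiff a p (fun q => conn q v).
Proof.
move=> ap i j; under [F in pdiff a F p]eq_fun do rewrite summxE.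
apply: pdiff_sum => k; under [F in pdiff a F p]eq_fun do rewrite mxE.
by apply: pdiffM; [exact: pdiff_cst|exact: christoffel_mdiff].
Qed.

Lemma dm_conn p v w : dom a p ->
  dm a p w (fun q => conn q v) = \sum_i v 0 i *: dm a p w (fun q => christoffel_mx a q i).
Proof.
move=> ap; apply/matrixP => j k; rewrite summxE !mxE.
under [F in dd a w F p]eq_fun do rewrite summxE.
rewrite dd_sum => [|i]; last first.
  under [F in pdiff a F p]eq_fun do rewrite mxE.
  by apply: pdiffM; [exact: pdiff_cst|exact: christoffel_mdiff].
apply: eq_bigr => i _; under [F in dd a w F p]eq_fun do rewrite mxE.
rewrite ddM //; [|exact: pdiff_cst|exact: christoffel_mdiff].
by rewrite dd_cst mul0r add0r [RHS]mxE; congr (_ * _); rewrite [RHS]mxE.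
Qed.

(* The curvature operator R(w, v), acting on rows from the right. *)
Definition curv_mx p w v : 'M[R]_n :=
  dm a p w (fun q => conn q v) - dm a p v (fun q => conn q w)
  + conn p v *m conn p w - conn p w *m conn p v.

(** Because matrices act from the right, [conn p v *m conn p w] differentiates along [w] last; this
    is the order of the quadratic terms in [curv_comp]. *)
Lemma curv_mxE p w v k l : dom a p ->
  curv_mx p w v k l = \sum_i \sum_j w 0 i * v 0 j * curv_comp a l k i j p.
Proof.
move=> ap.
have D x y : dm a p x (fun q => conn q y) k l =
    \sum_i \sum_j x 0 i * y 0 j * pd a i (christoffel a l j k) p.
  rewrite dm_conn // summxE exchange_big /=; apply: eq_bigr => j _.
  rewrite mxE [_ k l]mxE dd_coord; last exact: christoffel_mdiff.
  rewrite mulr_sumr; apply: eq_bigr => i _; rewrite mulrCA mulrA.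
  by congr (_ * _); apply: dd_near => //; apply: nearW => q; rewrite mxE.
have C x y : (conn p y *m conn p x) k l =
    \sum_i \sum_j x 0 i * y 0 j * \sum_s christoffel a l i s p * christoffel a s j k p.
  rewrite /conn mulmx_suml summxE exchange_big /=; apply: eq_bigr => j _.
  rewrite mulmx_sumr summxE; apply: eq_bigr => i _.
  rewrite -scalemxAl -scalemxAr scalerA mxE [y 0 j * _]mulrC; congr (_ * _).
  by rewrite mxE; apply: eq_bigr => s _; rewrite !mxE mulrC.
have E4 (W1 W2 W3 W4 : 'M[R]_n) :
  (W1 - W2 + W3 - W4) k l = W1 k l - W2 k l + W3 k l - W4 k l by rewrite !mxE.
rewrite /curv_mx E4 !D !C.
rewrite [X in _ - X + _ - _]exchange_big [X in _ - _ + _ - X]exchange_big /=.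
rewrite -!sumrN -!big_split; apply: eq_bigr => i _; rewrite /= -!sumrN -!big_split.
apply: eq_bigr => j _; rewrite /curv_comp /= [v 0 j * _]mulrC -!mulrN -!mulrDr.
by congr (_ * _); rewrite -addrA -sumrN -big_split.
Qed.

Lemma curvatureE p (U V W : 'rV[R]_n) : dom a p ->
  curvature a p U V W = W *m curv_mx p U V.
Proof.
move=> ap; apply/rowP => l; rewrite !mxE.
transitivity (\sum_k \sum_i \sum_j U 0 i * V 0 j * W 0 k * curv_comp a l k i j p).
  by rewrite [RHS]exchange_big; apply: eq_bigr => i _; rewrite exchange_big.
apply: eq_bigr => k _; rewrite curv_mxE // mulr_sumr; apply: eq_bigr => i _.
by rewrite mulr_sumr; apply: eq_bigr => j _; ring.
Qed.

(* w |-> R(w, v) v *)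
Definition jacobi_mx p v : 'M[R]_n := \matrix_i (v *m curv_mx p (delta_mx 0 i) v).

Lemma jacobi_mxE p v w : dom a p -> w *m jacobi_mx p v = v *m curv_mx p w v.
Proof.
move=> ap; apply/rowP => l; rewrite !mxE.
transitivity (\sum_i \sum_k w 0 i * (v 0 k * \sum_j v 0 j * curv_comp a l k i j p)).
  apply: eq_bigr => i _; rewrite !mxE mulr_sumr; apply: eq_bigr => k _.
  congr (_ * (_ * _)); rewrite curv_mxE // (bigD1 i) //= [X in _ + X]big1 ?addr0.
    by apply: eq_bigr => j _; rewrite mxE !eqxx mul1r.
  by move=> i' ii'; apply: big1 => j _; rewrite mxE (negPf ii') andbF !mul0r.
rewrite exchange_big; apply: eq_bigr => k _; rewrite curv_mxE // mulr_sumr.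
apply: eq_bigr => i _; rewrite mulrCA; congr (_ * _); rewrite mulr_sumr.
by apply: eq_bigr => j _; rewrite mulrA.
Qed.

Lemma ricciE p v : dom a p -> (v *m ricci a p *m v^T) 0 0 = \tr (jacobi_mx p v).
Proof.
move=> ap; rewrite /mxtrace.
transitivity (\sum_i \sum_k v 0 k * \sum_j v 0 j * curv_comp a i k i j p); last first.
  apply: eq_bigr => i _; rewrite !mxE; apply: eq_bigr => k _; congr (_ * _).
  rewrite curv_mxE // [RHS](bigD1 i) //= [X in _ + X]big1 ?addr0.
    by apply: eq_bigr => j _; rewrite mxE !eqxx mul1r.
  by move=> i' ii'; apply: big1 => j _; rewrite mxE (negPf ii') andbF !mul0r.
rewrite exchange_big mxE /=; apply: eq_bigr => k _.
rewrite mxE mulrC [v^T k 0]mxE -mulr_sumr exchange_big; congr (_ * _).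
by apply: eq_bigr => j _; rewrite mxE mulr_sumr.
Qed.

End ConnectionMatrix.

Section JacobianMatrix.
Variables (R : realType) (n : nat) (X : riemannianManifold R n) (a : chart X).
Variables (U : set X) (openU : open U).
Implicit Types (v w : 'rV[R]_n) (p : X).

Lemma smooth_in_pd i (F : X -> R) : smooth_in a U F -> smooth_in a U (pd a i F).
Proof.
move=> sF s p ap Up; have := sF (s ++ [:: i]) p ap Up.
by rewrite /iter_pd foldr_cat.
Qed.

Lemma ddC (F : X -> R) v w p : smooth_in a U F -> dom a p -> U p ->
  dd a w (fun q => dd a v F q) p = dd a v (fun q => dd a w F q) p.
Proof.
move=> sF ap Up.
have aUp : \forall q \near p, dom a q /\ U q.
  by near=> q; split; near: q; [apply: near_dom|apply: open_nbhs_nbhs].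
have E x y : dd a y (fun q => dd a x F q) p =
    \sum_i \sum_j x 0 i * y 0 j * pd a j (pd a i F) p.
  have -> : dd a y (fun q => dd a x F q) p = dd a y (fun q => \sum_i x 0 i * pd a i F q) p.
    apply: dd_near => //; apply: filterS aUp => q [aq Uq].
    by rewrite dd_coord //; exact: (smooth_pdiff [::] openU sF aq Uq).
  have dF i : pdiff a (pd a i F) p by exact: (smooth_pdiff [:: i] openU sF ap Up).
  rewrite dd_sum => [|i]; last by apply: pdiffM; [exact: pdiff_cst|].
  apply: eq_bigr => i _; rewrite ddM //; last exact: pdiff_cst.
  rewrite dd_cst mul0r add0r dd_coord // mulr_sumr.
  by apply: eq_bigr => j _; rewrite mulrA.
rewrite !E exchange_big; apply: eq_bigr => i _; apply: eq_bigr => j _.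
by rewrite (pdC i j openU sF ap Up) [v 0 j * _]mulrC.
Unshelve. all: by end_near. Qed.

Variables (m : nat) (c : 'I_m -> X -> R).
Hypothesis c_smooth : forall j, smooth_in a U (c j).

Definition jac p : 'M[R]_(n, m) := \matrix_(i, j) pd a i (c j) p.

Lemma jac_row v p j : dom a p -> U p -> (v *m jac p) 0 j = dd a v (c j) p.
Proof.
move=> ap Up; rewrite dd_coord; last exact: (smooth_pdiff [::] openU (c_smooth j) ap Up).
by rewrite mxE; apply: eq_bigr => i _; rewrite mxE.
Qed.

Lemma jac_mdiff p : dom a p -> U p -> mdiff a p jac.
Proof.
move=> ap Up i j; under [F in pdiff a F p]eq_fun do rewrite mxE.
exact: (smooth_pdiff [:: i] openU (c_smooth j) ap Up).
Qed.

(** Schwarz's theorem on rows: both sides have as components the second derivatives of the [c j]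
    along v and w. *)
Lemma dm_jac_sym p v w : dom a p -> U p -> w *m dm a p v jac = v *m dm a p w jac.
Proof.
move=> ap Up.
have E (x y : 'rV[R]_n) : y *m dm a p x jac = dm a p x (fun q => y *m jac q).
  by rewrite (dm_mull ap x y (jac_mdiff ap Up)).
have aUp : \forall q \near p, dom a q /\ U q.
  by near=> q; split; near: q; [apply: near_dom|apply: open_nbhs_nbhs].
rewrite (E v w) (E w v); apply/rowP => j; rewrite [LHS]dmE [RHS]dmE.
have N x y : dd a x (fun q => (y *m jac q) 0 j) p = dd a x (fun q => dd a y (c j) q) p.
  by apply: dd_near => //; apply: filterS aUp => q [aq Uq]; apply: jac_row.
by rewrite !N; apply: ddC.
Unshelve. all: by end_near. Qed.

Lemma dm_jac_mdiff p v : dom a p -> U p -> mdiff a p (fun q => dm a q v jac).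
Proof.
move=> ap Up i j; under [F in pdiff a F p]eq_fun do rewrite dmE.
have aUp : \forall q \near p, dom a q /\ U q.
  by near=> q; split; near: q; [apply: near_dom|apply: open_nbhs_nbhs].
have E : \forall q \near p, \sum_k v 0 k * pd a k (pd a i (c j)) q =
    dd a v (fun q' => jac q' i j) q.
  apply: filterS aUp => q [aq Uq]; rewrite dd_coord; last exact: jac_mdiff.
  apply: eq_bigr => k _; congr (_ * _); congr (pd a k _ q).
  by apply/funext => q'; rewrite mxE.
apply: (pdiff_near ap E); apply: pdiff_sum => k; apply: pdiffM; first exact: pdiff_cst.
exact: (smooth_pdiff [:: k; i] openU (c_smooth j) ap Up).
Unshelve. all: by end_near. Qed.

Lemma dm_jacC p v w : dom a p -> U p ->
  dm a p w (fun q => dm a q v jac) = dm a p v (fun q => dm a q w jac).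
Proof.
move=> ap Up; apply/matrixP => i j; rewrite [LHS]dmE [RHS]dmE.
have E x y : dd a y (fun q => dm a q x jac i j) p = dd a y (fun q => dd a x (pd a i (c j)) q) p.
  apply: dd_near => //; apply: nearW => q; rewrite dmE; congr (dd a x _ q).
  by apply/funext => q'; rewrite mxE.
by rewrite !E; apply: ddC => //; apply: smooth_in_pd.
Qed.

End JacobianMatrix.

(** * The Levi-Civita connection pulled back along a map *)

Section PullbackConnection.
Variables (R : realType) (n m : nat) (X : riemannianManifold R n) (Y : riemannianManifold R m).
Variables (psi : X -> Y) (a : chart X) (b : chart Y) (U : set X) (openU : open U).
Hypothesis psi_cont : continuous psi.
Hypothesis psi_dom : forall p, U p -> dom b (psi p).
Hypothesis psi_smooth : forall j, smooth_in a U (fun q => coord b (psi q) 0 j).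
Implicit Types (v w : 'rV[R]_n) (p : X).

Let J := dmap a b psi.

Lemma dd_along v (G : Y -> R) p : dom a p -> U p -> pdiff b G (psi p) ->
  dd a v (G \o psi) p = dd b (v *m J p) G (psi p).
Proof.
move=> ap Up dG; rewrite [RHS]dd_coord // (dd_comp (b := b)) //.
- apply: eq_bigr => k _; congr (_ * _); symmetry.
  exact: (jac_row openU psi_smooth _ _ ap Up).
- exact: psi_dom.
- exact: psi_cont.
- by move=> k; exact: (smooth_pdiff [::] openU (psi_smooth k) ap Up).
Qed.

Lemma pdiff_along (G : Y -> R) p : dom a p -> U p -> pdiff b G (psi p) ->
  pdiff a (G \o psi) p.
Proof.
move=> ap Up dG; apply: (pdiff_comp (b := b)) => //.
- exact: psi_dom.
- exact: psi_cont.
- by move=> k; exact: (smooth_pdiff [::] openU (psi_smooth k) ap Up).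
Qed.

Lemma mdiff_along k l (W : Y -> 'M[R]_(k, l)) p : dom a p -> U p ->
  mdiff b (psi p) W -> mdiff a p (fun q => W (psi q)).
Proof. by move=> ap Up dW i j; apply: (pdiff_along ap Up (dW i j)). Qed.

Lemma dm_along v k l (W : Y -> 'M[R]_(k, l)) p : dom a p -> U p ->
  mdiff b (psi p) W -> dm a p v (fun q => W (psi q)) = dm b (psi p) (v *m J p) W.
Proof.
move=> ap Up dW; apply/matrixP => i j; rewrite [LHS]dmE [RHS]dmE.
exact: (dd_along v ap Up (dW i j)).
Qed.

(* The connection of Y pulled back along psi. *)
Definition pconn v p : 'M[R]_m := conn b (psi p) (v *m J p).

Lemma pconn_compat v p : dom a p -> U p ->
  dm a p v (fun q => metric b (psi q)) =
  pconn v p *m metric b (psi p) + metric b (psi p) *m (pconn v p)^T.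
Proof.
move=> ap Up; have bp := psi_dom Up.
by rewrite dm_along //; [rewrite conn_compat|exact: metric_mdiff].
Qed.

Lemma pconn_sym v w p : U p -> (w *m J p) *m pconn v p = (v *m J p) *m pconn w p.
Proof. by move=> Up; apply: conn_sym; apply: psi_dom. Qed.

Let row_mdiff v p : dom a p -> U p -> mdiff a p (fun q => v *m J q).
Proof.
move=> ap Up.
exact: (mdiffM (mdiff_cst _ _ v) (jac_mdiff openU psi_smooth ap Up)).
Qed.

Lemma dm_dmap_sym v w p : dom a p -> U p ->
  dm a p w (fun q => v *m J q) = dm a p v (fun q => w *m J q).
Proof.
move=> ap Up; have dJ : mdiff a p J by exact: (jac_mdiff openU psi_smooth ap Up).
rewrite (dm_mull ap w v dJ) (dm_mull ap v w dJ).
exact: (dm_jac_sym openU psi_smooth w v ap Up).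
Qed.

Let chr_mdiff k p : dom a p -> U p -> mdiff a p (fun q => christoffel_mx b (psi q) k).
Proof.
move=> ap Up; have dC := christoffel_mdiff k (psi_dom Up).
exact: (mdiff_along ap Up dC).
Qed.

Lemma pconn_mdiff v p : dom a p -> U p -> mdiff a p (pconn v).
Proof.
move=> ap Up i j; under [F in pdiff a F p]eq_fun do rewrite summxE.
apply: pdiff_sum => k; under [F in pdiff a F p]eq_fun do rewrite mxE.
by apply: pdiffM; [exact: row_mdiff|exact: chr_mdiff].
Qed.

(** [pconn v] depends on the point through the Christoffel symbols along [psi] and through the
    vector [v *m J]. The first term freezes the vector, the second freezes the symbols. *)
Lemma dm_pconn v w p : dom a p -> U p -> dm a p w (pconn v) =
  dm b (psi p) (w *m J p) (fun y => conn b y (v *m J p)) +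
  conn b (psi p) (dm a p w (fun q => v *m J q)).
Proof.
move=> ap Up; have bp := psi_dom Up.
rewrite dm_conn // /conn -big_split /=; apply/matrixP => i j.
rewrite summxE dmE; under [F in dd a w F p]eq_fun do rewrite summxE.
rewrite dd_sum => [|k]; last first.
  under [F in pdiff a F p]eq_fun do rewrite mxE.
  by apply: pdiffM; [exact: row_mdiff|exact: chr_mdiff].
apply: eq_bigr => k _; under [F in dd a w F p]eq_fun do rewrite mxE.
rewrite ddM //; [|exact: row_mdiff|exact: chr_mdiff].
rewrite -(dm_along w ap Up); last exact: christoffel_mdiff.
by rewrite addrC [RHS]mxE; congr (_ + _); rewrite [RHS]mxE dmE.
Qed.

(** Naturality of curvature. The terms of [dm_pconn] with second derivatives of [psi] are symmetric
    in v and w, so they cancel in the difference. *)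
Lemma pconn_curv v w p : dom a p -> U p ->
  dm a p w (pconn v) - dm a p v (pconn w)
  + pconn v p *m pconn w p - pconn w p *m pconn v p
  = curv_mx b (psi p) (w *m J p) (v *m J p).
Proof.
move=> ap Up; rewrite !dm_pconn // (dm_dmap_sym v w ap Up) /curv_mx.
by congr (_ + _ - _); rewrite opprD addrACA subrr addr0.
Qed.

End PullbackConnection.

(** * The warped product *)

(** Used to reduce a partial derivative on the warped product to one on a single factor, by
    comparing values along a coordinate line; the chart lemmas above do not apply to the product
    itself. *)
Lemma derive_along_line (R : realType) (V W : normedModType R) (F : V -> R) (G : W -> R)
    (x v : V) (y w : W) :
  (forall s : R, F (s *: v + x) = G (s *: w + y)) -> 'D_v F x = 'D_w G y.
Proof.
move=> FG; have := FG 0; rewrite !scale0r !add0r => FG0.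
have E : (fun s : R => s^-1 *: ((F \o shift x) (s *: v) - F x)) =
         (fun s : R => s^-1 *: ((G \o shift y) (s *: w) - G y)).
  by apply/funext => s /=; rewrite FG FG0.
by rewrite /derive E.
Qed.

Lemma sum_block_mx (R : nmodType) (T : Type) (r : seq T) (P : pred T) m1 m2 k1 k2
    (A : T -> 'M[R]_(m1, k1)) (B : T -> 'M[R]_(m1, k2))
    (C : T -> 'M[R]_(m2, k1)) (D : T -> 'M[R]_(m2, k2)) :
  \sum_(i <- r | P i) block_mx (A i) (B i) (C i) (D i) =
  block_mx (\sum_(i <- r | P i) A i) (\sum_(i <- r | P i) B i)
    (\sum_(i <- r | P i) C i) (\sum_(i <- r | P i) D i).
Proof.
elim: r => [|i r IH]; first by rewrite !big_nil block_mx0.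
by rewrite !big_cons; case: (P i) => //; rewrite IH add_block_mx.
Qed.

Section WarpedConnection.
Variables (R : realType) (n : nat) (I : set R) (f : R -> R) (M : riemannianManifold R n).
Variables (b : chart M) (t : R) (x : M).
Hypotheses (bx : dom b x) (ft : f t != 0) (df : derivable f t 1).

Let Y := warped I f M.
Let y : Y := (t, x).
Let b' : chart Y := b.

Lemma warped_metricE : metric b' y = block_mx 1%:M 0 0 (f t ^+ 2 *: metric b x).
Proof. by []. Qed.

Lemma warped_metric_unit : metric b' y \in unitmx.
Proof.
rewrite warped_metricE unitmxE det_ublock det1 mul1r detZ unitrM -unitmxE.
by rewrite metric_unitmx // unitfE !expf_neq0.
Qed.

Lemma warped_metricT : (metric b' y)^T = metric b' y.
Proof.
rewrite warped_metricE tr_block_mx !trmx0 trmx1; congr block_mx.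
by rewrite linearZ /= (metric_sym (manifold_laws M) bx).
Qed.

Lemma pd_warped_l (F : Y -> R) : pd b' (lshift n 0) F y = 'D_1 (fun s : R => F (s, x)) t.
Proof.
apply: derive_along_line => s /=; congr F.
rewrite delta_mx_lshift scale_row_mx add_row_mx row_mxKl row_mxKr scaler0 add0r.
by rewrite (chart_cancel (manifold_laws M) bx) !mxE eqxx mulr1n.
Qed.

Lemma pd_warped_r j (F : Y -> R) : pd b' (rshift 1 j) F y = pd b j (fun z => F (t, z)) x.
Proof.
apply: derive_along_line => s /=; congr F.
rewrite delta_mx_rshift scale_row_mx add_row_mx row_mxKl row_mxKr scaler0 add0r.
by rewrite !mxE eqxx mulr1n.
Qed.

Let metric_blockE (s : R) z : metric b' ((s, z) : Y) =
  block_mx 1%:M 0 0 (f s ^+ 2 *: metric b z).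
Proof. by []. Qed.

Lemma dmetric_warped_l : dmetric b' y (lshift n 0) =
  block_mx 0 0 0 ((2 * f t * derive1 f t) *: metric b x).
Proof.
have dW : 'D_1 (fun s : R => f s ^+ 2) t = 2 * f t * derive1 f t.
  under [F in derive F]eq_fun do rewrite expr2.
  by rewrite derive1E (deriveM df df) /GRing.scale /=; ring.
apply/matrixP => i j; rewrite mxE pd_warped_l.
case: (split_ordP i) => i' ->; case: (split_ordP j) => j' ->;
  rewrite ?(block_mxEul, block_mxEur, block_mxEdl, block_mxEdr) mxE.
- by under [F in derive F]eq_fun do rewrite metric_blockE block_mxEul; exact: derive_cst.
- by under [F in derive F]eq_fun do rewrite metric_blockE block_mxEur mxE; exact: derive_cst.
- by under [F in derive F]eq_fun do rewrite metric_blockE block_mxEdl mxE; exact: derive_cst.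
under [F in derive F]eq_fun do rewrite metric_blockE block_mxEdr mxE mulrC.
have df2 : derivable (fun s => f s ^+ 2) t 1.
  by under [F in derivable F]eq_fun do rewrite expr2; exact: derivableM.
have := deriveZ (metric b x i' j') df2; rewrite dW => ->.
by rewrite [LHS]mulrC.
Qed.

Lemma dmetric_warped_r k : dmetric b' y (rshift 1 k) =
  block_mx 0 0 0 (f t ^+ 2 *: dmetric b x k).
Proof.
apply/matrixP => i j; rewrite mxE pd_warped_r.
case: (split_ordP i) => i' ->; case: (split_ordP j) => j' ->;
  rewrite ?(block_mxEul, block_mxEur, block_mxEdl, block_mxEdr) mxE.
- by under [F in pd b k F]eq_fun do rewrite metric_blockE block_mxEul; apply: dd_cst.
- by under [F in pd b k F]eq_fun do rewrite metric_blockE block_mxEur mxE; apply: dd_cst.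
- by under [F in pd b k F]eq_fun do rewrite metric_blockE block_mxEdl mxE; apply: dd_cst.
under [F in pd b k F]eq_fun do rewrite metric_blockE block_mxEdr mxE.
rewrite mxE pdE (ddM _ bx (pdiff_cst b (f t ^+ 2) x) (metric_mdiff bx i' j')).
by rewrite dd_cst mul0r add0r.
Qed.

(** The classical formulas for a warped product: nabla of d_j along d_t, and of d_t along d_j, is
    (f'/f) d_j, while nabla of d_j along d_i is -f f' g_ij d_t plus the fiber connection. *)
Definition warped_conn (k : 'I_(1 + n)) : 'M[R]_(1 + n) :=
  match fintype.split k with
  | inl _ => block_mx 0 0 0 (derive1 f t / f t)%:M
  | inr j => block_mx 0 (derive1 f t / f t *: delta_mx 0 j)
      (- (f t * derive1 f t) *: (metric b x *m delta_mx j 0)) (christoffel_mx b x j)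
  end.

Let warped_conn_l : warped_conn (lshift n 0) = block_mx 0 0 0 (derive1 f t / f t)%:M.
Proof. by rewrite /warped_conn (unsplitK (inl 0)). Qed.

Let warped_conn_r j : warped_conn (rshift 1 j) =
  block_mx 0 (derive1 f t / f t *: delta_mx 0 j)
    (- (f t * derive1 f t) *: (metric b x *m delta_mx j 0)) (christoffel_mx b x j).
Proof. by rewrite /warped_conn (unsplitK (inr j)). Qed.

(** By [christoffel_unique] it is enough to check compatibility and symmetry block by block. The
    off-diagonal blocks vanish because (f'/f) f^2 = f f'. *)
Lemma christoffel_warped k : christoffel_mx b' y k = warped_conn k.
Proof.
have dT l : (dmetric b' y l)^T = dmetric b' y l.
  case: (split_ordP l) => j ->.
    rewrite ord1 dmetric_warped_l tr_block_mx !trmx0; congr block_mx.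
    by rewrite linearZ /= (metric_sym (manifold_laws M) bx).
  rewrite dmetric_warped_r tr_block_mx !trmx0; congr block_mx.
  by rewrite linearZ /= dmetric_sym.
move: k; apply: (christoffel_unique warped_metric_unit warped_metricT dT).
  move=> l; rewrite warped_metricE.
  case: (split_ordP l) => j ->.
    rewrite ord1 warped_conn_l dmetric_warped_l tr_block_mx !mulmx_block.
    rewrite !trmx0 !mul0mx !mulmx0 !addr0 !add0r add_block_mx !addr0; congr block_mx.
    rewrite tr_scalar_mx mul_scalar_mx mul_mx_scalar !scalerA -scalerDl.
    by congr (_ *: _); field.
  rewrite warped_conn_r dmetric_warped_r tr_block_mx !mulmx_block.
  rewrite !trmx0 !mul0mx !mulmx0 !addr0 !add0r add_block_mx !addr0 !mulmx1 !mul1mx.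
  rewrite -!scalemxAl -!scalemxAr -scalerDr christoffel_compat.
  - have c0 : derive1 f t / f t * f t ^+ 2 + - (f t * derive1 f t) = 0 by field.
    have c1 : - (f t * derive1 f t) + f t ^+ 2 * (derive1 f t / f t) = 0 by field.
    have trZ m1 m2 (c : R) (W : 'M[R]_(m1, m2)) : (c *: W)^T = c *: W^T by exact: linearZ.
    rewrite !trZ !trmx_mul !trmx_delta (metric_sym (manifold_laws M) bx) -scalemxAr.
    by rewrite !scalerA -!scalerDl c0 c1 !scale0r.
  - exact: metric_unitmx.
  - exact: metric_sym (manifold_laws M) _ _ bx.
  - by move=> m; exact: dmetric_sym.
move=> i j l; case: (split_ordP i) => i' ->; case: (split_ordP j) => j' ->;
  rewrite ?(ord1 i') ?(ord1 j') ?warped_conn_l ?warped_conn_r //;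
  case: (split_ordP l) => l' ->;
  rewrite ?(block_mxEul, block_mxEur, block_mxEdl, block_mxEdr) -?colE ?mxE //.
- by rewrite eqxx mulr_natr eq_sym.
- by rewrite eqxx mulr_natr eq_sym.
- by rewrite -[in LHS](metric_sym (manifold_laws M) bx) [in LHS]mxE.
- by have := christoffel_mxC i' j' l' bx; rewrite !mxE.
Qed.

(** Contraction of the ambient Christoffel symbols with a tangent vector (z0, Z); this is the block
    form that [wconn] takes along a map. *)
Lemma sum_christoffel_warped (z0 : R) (Z : 'rV[R]_n) :
  \sum_k (row_mx z0%:M Z : 'rV[R]_(1 + n)) 0 k *: christoffel_mx b' y k =
  block_mx 0 (derive1 f t / f t *: Z)
    (- (f t * derive1 f t) *: (metric b x *m Z^T))
    ((derive1 f t / f t * z0)%:M + conn b x Z).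
Proof.
rewrite big_split_ord big_ord1 /= christoffel_warped warped_conn_l row_mxEl mxE eqxx mulr1n.
under eq_bigr do rewrite christoffel_warped warped_conn_r row_mxEr.
rewrite scale_block_mx !scaler0 scale_scalar_mx [z0 * _]mulrC.
under eq_bigr do rewrite scale_block_mx.
rewrite sum_block_mx add_block_mx !add0r; congr block_mx.
- by apply: big1 => i _; rewrite scaler0.
- by rewrite [in RHS](row_sum_delta Z) scaler_sumr; apply: eq_bigr => i _; rewrite !scalerA mulrC.
- have -> : Z^T = \sum_i Z 0 i *: delta_mx i 0.
    rewrite {1}(row_sum_delta Z) linear_sum; apply: eq_bigr => i _.
    by rewrite (linearZ _ (delta_mx _ _)) /= trmx_delta.
  rewrite mulmx_sumr scaler_sumr; apply: eq_bigr => i _.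
  by rewrite -scalemxAr !scalerA mulrC.
Qed.

End WarpedConnection.

(** * The Gauss equation *)

(** The argument of [sym_antisym_eq0] with vectors in place of indices, applied to T(u, w, x) = w
    K(u) x^T. It serves to identify the tangential part of the ambient derivative. *)
Lemma sym_antisym_row_eq0 (R : realType) (n : nat) (K : 'rV[R]_n -> 'M[R]_n) :
  (forall v w, w *m K v = v *m K w) -> (forall v, K v + (K v)^T = 0) ->
  forall v, K v = 0.
Proof.
move=> Ks Ka v; pose T (u w x : 'rV[R]_n) := (w *m K u *m x^T) 0 0.
have Ts u w x : T u w x = T w u x by rewrite /T Ks.
have Ta u w x : T u w x = - T u x w.
  rewrite /T; have /eqP := Ka u; rewrite addr_eq0 => /eqP KE; rewrite [in LHS]KE.
  rewrite mulmxN mulNmx mxE; congr (- _).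
  have -> : x *m K u *m w^T = (w *m (K u)^T *m x^T)^T by rewrite !trmx_mul !trmxK mulmxA.
  by rewrite [RHS]mxE.
have T0 u w x : T u w x = 0.
  suff : T u w x = - T u w x by lra.
  by rewrite {1}Ts Ta Ts Ta opprK Ts Ta.
apply/matrixP => i j; rewrite mxE -(T0 v (delta_mx 0 i) (delta_mx 0 j)) /T.
by rewrite trmx_delta -rowE -colE !mxE.
Qed.

(* P is the differential of an isometric immersion, G the ambient metric along it,
   and Om v the ambient connection matrix pulled back along v. *)
Section GaussEquation.
Variables (R : realType) (n : nat) (X : riemannianManifold R n) (a : chart X).
Variables (U : set X) (openU : open U) (domU : forall q, U q -> dom a q).
Variables (P : X -> 'M[R]_(n, 1 + n)) (G : X -> 'M[R]_(1 + n)) (nu : X -> 'rV[R]_(1 + n)).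
Variables (Om : 'rV[R]_n -> X -> 'M[R]_(1 + n)) (A : X -> 'M[R]_n).
Implicit Types (v w : 'rV[R]_n) (p q : X).

Hypothesis P_diff : forall q, U q -> mdiff a q P.
Hypothesis dP_diff : forall q v, U q -> mdiff a q (fun q' => dm a q' v P).
Hypothesis G_diff : forall q, U q -> mdiff a q G.
Hypothesis nu_diff : forall q, U q -> mdiff a q nu.
Hypothesis Om_diff : forall q v, U q -> mdiff a q (Om v).
Hypothesis dPC : forall q v w, U q ->
  dm a q w (fun q' => dm a q' v P) = dm a q v (fun q' => dm a q' w P).
Hypothesis GT : forall q, U q -> (G q)^T = G q.
Hypothesis PGP : forall q, U q -> P q *m G q *m (P q)^T = metric a q.
Hypothesis PGnu : forall q, U q -> P q *m G q *m (nu q)^T = 0.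
Hypothesis nuGnu : forall q, U q -> nu q *m G q *m (nu q)^T = 1%:M.
Hypothesis G_compat : forall q v, U q ->
  dm a q v G = Om v q *m G q + G q *m (Om v q)^T.

(* The j-th row is the ambient derivative along v of the image of d_j. *)
Definition hess_map v q : 'M[R]_(n, 1 + n) := dm a q v P + P q *m Om v q.

Hypothesis hess_map_sym : forall q v w, U q -> w *m hess_map v q = v *m hess_map w q.
Hypothesis weingarten : forall q v, U q ->
  dm a q v nu + nu q *m Om v q = - (v *m A q *m P q).

(** Entry j is the normal component of the ambient derivative along v of the image of d_j: the
    second fundamental form with one argument fixed. *)
Definition second_form v q : 'cV[R]_n := hess_map v q *m G q *m (nu q)^T.

Let nearU q : U q -> \forall q' \near q, U q'.
Proof. by move=> Uq; apply: open_nbhs_nbhs. Qed.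

Let hess_map_diff q v : U q -> mdiff a q (hess_map v).
Proof.
move=> Uq; exact: (mdiffD (dP_diff v Uq) (mdiffM (P_diff Uq) (Om_diff v Uq))).
Qed.

(** Differentiate the orthogonality [PGnu] along v. Compatibility of G with the connection moves the
    derivative from P to nu, where the Weingarten equation brings in A. *)
Lemma second_formE v q : U q -> second_form v q = metric a q *m (v *m A q)^T.
Proof.
move=> Uq; have aq := domU Uq; have nuT := mdiff_tr (nu_diff Uq).
have PG := mdiffM (P_diff Uq) (G_diff Uq).
have : dm a q v (fun q => P q *m G q *m (nu q)^T) = 0.
  rewrite -(dm_cst a q v (0 : 'cV[R]_n)); apply: dm_near => //.
  exact: filterS (nearU Uq).
rewrite (dmM aq v PG nuT) (dmM aq v (P_diff Uq) (G_diff Uq)) dm_tr G_compat //.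
have -> : dm a q v nu = - (v *m A q *m P q) - nu q *m Om v q.
  by rewrite -weingarten // addrK.
rewrite linearB /= linearN /= !trmx_mul -(PGP Uq) => E.
apply/eqP; rewrite -subr_eq0 -{}E /second_form /hess_map.
rewrite !mulmxDl !mulmxDr !mulmxN !mulmxDl !mulmxA; apply/eqP.
by rewrite !addrA [RHS]addrAC addrK.
Qed.

(* The difference of the two sides is orthogonal to the frame (nu, P): its
   tangential part is symmetric in two arguments and antisymmetric in two. *)
Lemma gauss_formula q v : U q ->
  hess_map v q = conn a q v *m P q + second_form v q *m nu q.
Proof.
move=> Uq; have aq := domU Uq.
have nuGP : nu q *m G q *m (P q)^T = 0.
  have -> : nu q *m G q *m (P q)^T = (P q *m G q *m (nu q)^T)^T.
    by rewrite !trmx_mul trmxK GT // mulmxA.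
  by rewrite PGnu // trmx0.
(* Symmetry comes from the torsion-freeness of both connections. Antisymmetry comes from
   differentiating the induced metric in two ways, intrinsically and as P G P^T. *)
have K0 : (hess_map v q - conn a q v *m P q) *m G q *m (P q)^T = 0.
  move: v; apply: sym_antisym_row_eq0 => [v w|v].
    by rewrite !mulmxA !mulmxBr !mulmxA hess_map_sym // conn_sym.
  have : dm a q v (metric a) = dm a q v (fun q => P q *m G q *m (P q)^T).
    apply: dm_near => //; apply: filterS (nearU Uq) => q' Uq'.
    by rewrite PGP.
  rewrite -conn_compat // (dmM aq v (mdiffM (P_diff Uq) (G_diff Uq)) (mdiff_tr (P_diff Uq))).
  rewrite (dmM aq v (P_diff Uq) (G_diff Uq)) dm_tr G_compat // -PGP // => E.
  rewrite /hess_map !(mulmxBl, mulmxDl) !linearB !linearD /= !trmx_mul !trmxK GT //.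
  move: E; rewrite !(mulmxDl, mulmxDr) !mulmxA => E.
  rewrite addrACA -opprD E; apply/eqP; rewrite subr_eq0; apply/eqP.
  by rewrite -!addrA; congr (_ + (_ + _)); rewrite addrC.
set L := hess_map v q - conn a q v *m P q.
have L1 : (L - second_form v q *m nu q) *m G q *m (nu q)^T = 0.
  rewrite /L 4!mulmxBl -[X in _ - X - _]mulmxA -[X in _ - X - _]mulmxA.
  rewrite -[X in _ - _ - X]mulmxA -[X in _ - _ - X]mulmxA (mulmxA (P q)) (mulmxA (nu q)).
  by rewrite PGnu // nuGnu // mulmx0 mulmx1 subr0 subrr.
have L2 : (L - second_form v q *m nu q) *m G q *m (P q)^T = 0.
  rewrite 2!mulmxBl K0 -[X in _ - X]mulmxA -[X in _ - X]mulmxA (mulmxA (nu q)).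
  by rewrite nuGP mulmx0 subrr.
have : (L - second_form v q *m nu q) *m (G q *m (col_mx (nu q) (P q))^T) = 0.
  by rewrite tr_col_mx mul_mx_row mul_mx_row !mulmxA L1 L2 row_mx0.
(* The Gram matrix of the frame (nu, P) is block diagonal with blocks 1 and the induced metric,
   hence invertible; so pairing with the frame is injective. *)
have KK : col_mx (nu q) (P q) *m (G q *m (col_mx (nu q) (P q))^T) \in unitmx.
  rewrite tr_col_mx mul_mx_row mul_col_row !mulmxA nuGnu // nuGP PGnu // PGP //.
  by rewrite unitmxE det_ublock det1 mul1r -unitmxE metric_unitmx.
move: KK; rewrite unitmx_mul => /andP[_ uK].
move=> /(congr1 (mulmx^~ (invmx (G q *m (col_mx (nu q) (P q))^T)))).
rewrite mulmxK // mul0mx => /eqP; rewrite -addrA -opprD subr_eq0 => /eqP ->.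
by [].
Qed.

(** Cancellation behind the antisymmetrization: D is the common second derivative of P, and the
    mixed products s and t recur with exchanged indices on the opposite side of the other
    equation. *)
Let gauss_algebra (D s1 s2 t1 t2 o1 o2 d1 d2 c1 c2 k1 k2 b1 b2 : 'M[R]_n) :
  D + s1 + t1 - o1 + d1 = c1 + k1 - s2 - b1 - t2 ->
  D + s2 + t2 - o2 + d2 = c2 + k2 - s1 - b2 - t1 ->
  d1 - d2 + o2 - o1 = c1 - c2 + k1 - k2 - (b1 - b2).
Proof.
move=> /matrixP e1 /matrixP e2; apply/matrixP => i j.
by have := e1 i j; have := e2 i j; rewrite !mxE; lra.
Qed.

(* Differentiate the Gauss formula along w, antisymmetrize in v and w, and
   multiply by G P^T to keep the tangential part. *)
Lemma gauss_equation q v w : U q ->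
  P q *m (dm a q w (Om v) - dm a q v (Om w) + Om v q *m Om w q - Om w q *m Om v q)
    *m (G q *m (P q)^T) =
  curv_mx a q w v *m metric a q -
  (second_form v q *m (w *m A q) - second_form w q *m (v *m A q)) *m metric a q.
Proof.
move=> Uq; have aq := domU Uq; set H := G q *m (P q)^T.
have PH : P q *m H = metric a q by rewrite /H mulmxA PGP.
have nuH : nu q *m H = 0.
  have -> : nu q *m H = (P q *m G q *m (nu q)^T)^T.
    by rewrite !trmx_mul trmxK GT // mulmxA.
  by rewrite PGnu // trmx0.
have dB x : mdiff a q (second_form x).
  exact: (mdiffM (mdiffM (hess_map_diff x Uq) (G_diff Uq)) (mdiff_tr (nu_diff Uq))).
have dPE x : dm a q x P = conn a q x *m P q + second_form x q *m nu q - P q *m Om x q.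
  by rewrite -gauss_formula // addrK.
have dnuE x : dm a q x nu = - (x *m A q *m P q) - nu q *m Om x q.
  by rewrite -weingarten // addrK.
have E x y : dm a q y (fun q' => dm a q' x P) *m H + conn a q y *m P q *m Om x q *m H
    + second_form y q *m nu q *m Om x q *m H - P q *m Om y q *m Om x q *m H
    + P q *m dm a q y (Om x) *m H
  = dm a q y (fun q' => conn a q' x) *m metric a q + conn a q x *m conn a q y *m metric a q
    - conn a q x *m P q *m Om y q *m H - second_form x q *m (y *m A q) *m metric a q
    - second_form x q *m nu q *m Om y q *m H.
  have : dm a q y (hess_map x) =
      dm a q y (fun q' => conn a q' x *m P q' + second_form x q' *m nu q').
    apply: dm_near => //; apply: filterS (nearU Uq) => q' Uq'.
    by rewrite gauss_formula.
  have dC := conn_mdiff x aq.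
  rewrite (dmD y (dP_diff x Uq) (mdiffM (P_diff Uq) (Om_diff x Uq))).
  rewrite (dmM aq y (P_diff Uq) (Om_diff x Uq)).
  rewrite (dmD y (mdiffM dC (P_diff Uq)) (mdiffM (dB x) (nu_diff Uq))).
  rewrite (dmM aq y dC (P_diff Uq)) (dmM aq y (dB x) (nu_diff Uq)) dPE dnuE.
  move=> /(congr1 (mulmx^~ H)).
  rewrite !(mulmxDl, mulmxDr, mulmxBl, mulmxBr, mulmxN, mulNmx) -!mulmxA PH nuH !mulmx0.
  by rewrite !addr0 !add0r !addrA.
have Evw := E v w; have := E w v; rewrite -dPC // => Ewv.
have := gauss_algebra Evw Ewv.
rewrite /curv_mx !(mulmxBl, mulmxDl, mulmxBr, mulmxDr) !mulmxA => EE.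
by move: EE; rewrite !mulNmx.
Qed.

End GaussEquation.

Lemma ddV (R : realType) (n : nat) (X : riemannianManifold R n) (a : chart X)
    (v : 'rV[R]_n) (F : X -> R) (p : X) :
  dom a p -> F p != 0 -> pdiff a F p ->
  dd a v (fun q => (F q)^-1) p = - (F p) ^- 2 * dd a v F p.
Proof.
move=> ap Fp dF; have pa := chart_cancel (manifold_laws X) ap.
have Fp' : (F \o param a) (coord a p) != 0 by rewrite /= pa.
have := deriveV Fp' (diff_derivable (v := v) dF).
by rewrite /= pa.
Qed.

(** * Curvature of the warped product along a map *)

Section WarpedCurvature.
Variables (R : realType) (n m : nat) (X : riemannianManifold R n) (M : riemannianManifold R m).
Variables (psi : X -> M) (h : X -> R) (f : R -> R) (a : chart X) (b : chart M).
Variables (U : set X) (openU : open U).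
Hypothesis psi_cont : continuous psi.
Hypothesis psi_dom : forall p, U p -> dom b (psi p).
Hypothesis psi_smooth : forall j, smooth_in a U (fun q => coord b (psi q) 0 j).
Hypothesis h_smooth : smooth_in a U h.
Hypothesis f_derivable : forall p, U p -> derivable f (h p) 1.
Hypothesis df_derivable : forall p, U p -> derivable (derive1 f) (h p) 1.
Hypothesis f_neq0 : forall p, U p -> f (h p) != 0.
Implicit Types (v w : 'rV[R]_n) (p : X).

Let J := dmap a b psi.
Let G p := metric b (psi p).
Let F0 p := f (h p).
Let F1 p := derive1 f (h p).
Let F2 p := derive1 (derive1 f) (h p).

(* The connection of I x_f M, pulled back along (h, psi). *)
Definition wconn v p : 'M[R]_(1 + m) :=
  block_mx 0 (F1 p / F0 p *: (v *m J p))
    (- (F0 p * F1 p) *: (G p *m (v *m J p)^T))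
    ((F1 p / F0 p * dd a v h p)%:M + pconn psi a b v p).

Definition wmetric p : 'M[R]_(1 + m) := block_mx 1%:M 0 0 (F0 p ^+ 2 *: G p).

Section AtPoint.
Variables (p : X) (ap : dom a p) (Up : U p).

Let dh : pdiff a h p := smooth_pdiff [::] openU h_smooth ap Up.

Let dF0 : pdiff a F0 p := pdiff_comp_real ap (f_derivable Up) dh.

Let dF1 : pdiff a F1 p := pdiff_comp_real ap (df_derivable Up) dh.

Let dF0E v : dd a v F0 p = F1 p * dd a v h p.
Proof. exact: (dd_comp_real v ap (f_derivable Up) dh). Qed.

Let dF1E v : dd a v F1 p = F2 p * dd a v h p.
Proof. exact: (dd_comp_real v ap (df_derivable Up) dh). Qed.

Let F0V : pdiff a (fun q => (F0 q)^-1) p.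
Proof. exact: (pdiffV (f_neq0 Up) ap dF0). Qed.

Let dk : pdiff a (fun q => F1 q / F0 q) p := pdiffM dF1 F0V.

Let dc : pdiff a (fun q => - (F0 q * F1 q)) p := pdiffN (pdiffM dF0 dF1).

Let dkE v : dd a v (fun q => F1 q / F0 q) p = (F2 p / F0 p - (F1 p / F0 p) ^+ 2) * dd a v h p.
Proof.
rewrite (ddM v ap dF1 F0V) (ddV v ap (f_neq0 Up) dF0) dF0E dF1E.
by have F0p : F0 p != 0 := f_neq0 Up; field.
Qed.

Let dcE v : dd a v (fun q => - (F0 q * F1 q)) p =
  - (F1 p ^+ 2 + F0 p * F2 p) * dd a v h p.
Proof.
rewrite (ddN v (pdiffM dF0 dF1)) (ddM v ap dF0 dF1) dF0E dF1E; ring.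
Qed.

Let dG : mdiff a p G.
Proof.
have dm := metric_mdiff (psi_dom Up).
exact: (mdiff_along openU psi_cont psi_dom psi_smooth ap Up dm).
Qed.

Let dV v : mdiff a p (fun q => v *m J q).
Proof. exact: (mdiffM (mdiff_cst _ _ v) (jac_mdiff openU psi_smooth ap Up)). Qed.

Let dhv v : pdiff a (fun q => dd a v h q) p.
Proof.
have E : \forall q \near p, \sum_i v 0 i * pd a i h q = dd a v h q.
  have aUp : \forall q \near p, dom a q /\ U q.
    by apply: filterI; [exact: near_dom|apply: open_nbhs_nbhs].
  apply: filterS aUp => q [aq Uq].
  by rewrite (dd_coord v (smooth_pdiff [::] openU h_smooth aq Uq)).
apply: (pdiff_near ap E); apply: pdiff_sum => i; apply: pdiffM; first exact: pdiff_cst.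
exact: (smooth_pdiff [:: i] openU h_smooth ap Up).
Qed.

Let dpc v : mdiff a p (pconn psi a b v).
Proof. exact: (pconn_mdiff openU psi_cont psi_dom psi_smooth v ap Up). Qed.

Lemma wconn_mdiff v : mdiff a p (wconn v).
Proof.
apply: mdiff_block; first exact: mdiff_cst.
- exact: mdiffZ dk (dV v).
- exact: mdiffZ dc (mdiffM dG (mdiff_tr (dV v))).
- apply: mdiffD; [apply: mdiff_scalar; exact: pdiffM dk (dhv v)|exact: dpc].
Qed.

Lemma wmetric_mdiff : mdiff a p wmetric.
Proof.
apply: mdiff_block; try exact: mdiff_cst.
exact: mdiffZ (pdiffM dF0 dF0) dG.
Qed.

Let GT : (G p)^T = G p := metric_sym (manifold_laws M) (psi_dom Up).

Lemma wmetricT : (wmetric p)^T = wmetric p.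
Proof. by rewrite tr_block_mx !trmx0 trmx1 (linearZ _ (G p)) /= GT. Qed.

(** Verified by blocks, as [conn_compat] requires a [riemannianManifold]; the fiber block reduces to
    [pconn_compat] and the derivative 2 f f' dh of f^2. *)
Lemma wconn_compat v : dm a p v wmetric =
  wconn v p *m wmetric p + wmetric p *m (wconn v p)^T.
Proof.
have F0p : F0 p != 0 := f_neq0 Up.
rewrite dm_block !dm_cst (dmZ ap v (pdiffM dF0 dF0) dG) (ddM v ap dF0 dF0) dF0E.
rewrite (pconn_compat openU psi_cont psi_dom psi_smooth v ap Up) -/(G p).
rewrite /wconn /wmetric; move: (v *m J p) => V; rewrite tr_block_mx !mulmx_block !trmx0.
rewrite !mul0mx !mulmx0 !mulmx1 !mul1mx !addr0 !add0r add_block_mx addr0.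
have trZ m1 m2 (c : R) (W : 'M[R]_(m1, m2)) : (c *: W)^T = c *: W^T by exact: linearZ.
have trD m1 m2 (W Z : 'M[R]_(m1, m2)) : (W + Z)^T = W^T + Z^T by exact: linearD.
rewrite !trZ !trmx_mul trmxK GT trD tr_scalar_mx.
rewrite !mulmxDl !mulmxDr mul_scalar_mx mul_mx_scalar -?scalemxAl -?scalemxAr !scalerA.
have c0 : F1 p / F0 p * F0 p ^+ 2 + - (F0 p * F1 p) = 0 by field.
have c1 : - (F0 p * F1 p) + F0 p ^+ 2 * (F1 p / F0 p) = 0 by field.
rewrite -[X in _ = block_mx _ X _ _]scalerDl -[X in _ = block_mx _ _ X _]scalerDl.
rewrite c0 c1 !scale0r; congr block_mx.
rewrite addrACA -scalerDl !scalerDr -!expr2; congr (_ *: _ + _).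
by field.
Qed.

Let V v := v *m J p.

(** Three symmetries remove all second derivatives and bare connection terms: those of the second
    derivatives of [psi] ([Ys]) and of [h] ([hs]), and torsion-freeness in the fiber ([VP]). The
    squares of f'/f from the quotient rule cancel against the products of connection blocks, leaving
    f''/f. *)
Lemma wconn_curv v w :
  dm a p w (wconn v) - dm a p v (wconn w) + wconn v p *m wconn w p - wconn w p *m wconn v p =
  let Z := dd a w h p *: V v - dd a v h p *: V w in
  block_mx 0 (F2 p / F0 p *: Z) (- (F0 p * F2 p) *: (G p *m Z^T))
    (curv_mx b (psi p) (V w) (V v)
     + F1 p ^+ 2 *: (G p *m ((V w)^T *m V v - (V v)^T *m V w))).
Proof.
have F0p : F0 p != 0 := f_neq0 Up.
have D x y : dm a p y (wconn x) = block_mx 0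
    ((F2 p / F0 p - (F1 p / F0 p) ^+ 2) * dd a y h p *: V x
       + F1 p / F0 p *: dm a p y (fun q => x *m J q))
    ((- (F1 p ^+ 2 + F0 p * F2 p) * dd a y h p) *: (G p *m (V x)^T)
       + - (F0 p * F1 p) *: (pconn psi a b y p *m G p *m (V x)^T
            + G p *m (V x *m pconn psi a b y p)^T
            + G p *m (dm a p y (fun q => x *m J q))^T))
    (((F2 p / F0 p - (F1 p / F0 p) ^+ 2) * dd a y h p * dd a x h p
       + F1 p / F0 p * dd a y (dd a x h) p)%:M + dm a p y (pconn psi a b x)).
  rewrite dm_block dm_cst (dmZ ap y dk (dV x)) dkE (dmZ ap y dc (mdiffM dG (mdiff_tr (dV x)))).
  rewrite dcE (dmM ap y dG (mdiff_tr (dV x))) dm_tr.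
  rewrite (pconn_compat openU psi_cont psi_dom psi_smooth y ap Up) -/(G p).
  rewrite (dmD y (mdiff_scalar (pdiffM dk (dhv x))) (dpc x)) dm_scalar (ddM y ap dk (dhv x)) dkE.
  by rewrite -/(V x) mulmxDl [(V x *m _)^T]trmx_mul !mulmxA.
have Ys : dm a p w (fun q => v *m J q) = dm a p v (fun q => w *m J q).
  exact: (dm_dmap_sym openU psi_smooth).
have hs : dd a w (dd a v h) p = dd a v (dd a w h) p by exact: (ddC openU).
have VP : V v *m pconn psi a b w p = V w *m pconn psi a b v p.
  exact: (pconn_sym a psi_dom w v Up).
rewrite -(pconn_curv openU psi_cont psi_dom psi_smooth v w ap Up) !D Ys hs VP /wconn -/(V v) -/(V w).
move: (V v) (V w) (pconn psi a b v p) (pconn psi a b w p) VP.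
move: (dm a p w (pconn psi a b v)) (dm a p v (pconn psi a b w)).
move: (dm a p v (fun q => w *m J q)) (dd a v (dd a w h) p) (dd a v h p) (dd a w h p) => Y hh v0 w0.
move=> dpv dpw W1 W2 p1 p2 VP.
move: (G p) GT (F0 p) F0p (F1 p) (F2 p) => g gT f0 f0p f1 f2.
have trZ m1 m2 (c : R) (W : 'M[R]_(m1, m2)) : (c *: W)^T = c *: W^T by exact: linearZ.
have trB m1 m2 (W Z : 'M[R]_(m1, m2)) : (W - Z)^T = W^T - Z^T by exact: linearB.
rewrite !mulmx_block !opp_block_mx !add_block_mx !mul0mx !mulmx0 !(add0r, addr0, oppr0).
rewrite !trB !trZ ?mulmxBr -?scalemxAr -?scalemxAl ?mulmxDl ?mulmxDr.
rewrite -?scalemxAr -?scalemxAl ?mul_scalar_mx ?mul_mx_scalar ?mulmxA.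
rewrite trmx_mul VP ?mulmxA -?scalemxAr; congr block_mx.
(* In the upper-left block the two products are 1 by 1 and transposes of each other. *)
- have -> : W2 *m g *m W1^T = (W1 *m g *m W2^T)^T by rewrite !trmx_mul trmxK gT mulmxA.
  by rewrite [W1 *m g *m W2^T]mx11_scalar tr_scalar_mx subrr.
- move: (W2 *m p1) => K; apply/rowP => j; rewrite !mxE; by field.
- move: (p2 *m g *m W1^T) (p1 *m g *m W2^T) (g *m p1^T *m W2^T) (g *m Y^T) => k1 k2 k3 k4.
  move: (g *m W1^T) (g *m W2^T) => k5 k6.
  apply/matrixP => i j; rewrite !mxE; by field.
- move: (g *m W1^T *m W2) (g *m W2^T *m W1) (p1 *m p2) (p2 *m p1) => k1 k2 k3 k4.
  rewrite !scale_scalar_mx; apply/matrixP => i j; rewrite !mxE.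
  by case: (i == j); rewrite ?mulr1n ?mulr0n; field.
Qed.

End AtPoint.
End WarpedCurvature.

(** * Orthonormal frames and curvature of planes *)

(* Induction on the Schur complement g' of the first diagonal entry. *)
Lemma orthonormal_frame (R : rcfType) n (g : 'M[R]_n) :
  g^T = g -> (forall v : 'rV[R]_n, v != 0 -> 0 < (v *m g *m v^T) 0 0) ->
  exists E : 'M[R]_n, E *m g *m E^T = 1%:M.
Proof.
elim: n g => [|n IH] g gT gpos; first by exists 0; apply/matrixP => -[].
rewrite -[n.+1]/(1 + n)%N in g gT gpos *.
pose c := ulsubmx g; pose r := ursubmx g; pose d := drsubmx g.
have gE : g = block_mx c r r^T d.
  rewrite -[LHS]submxK; congr block_mx.
  by rewrite /r trmx_ursub gT.
have c0 : 0 < c 0 0.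
  have := gpos (row_mx 1%:M 0); rewrite gE mul_row_block !mul1mx !mul0mx !addr0.
  rewrite tr_row_mx trmx1 trmx0 mul_row_col mulmx1 mulmx0 addr0; apply.
  rewrite row_mx_eq0 negb_and; apply/orP; left.
  by apply/eqP => /matrixP/(_ 0 0); rewrite !mxE eqxx => /eqP; rewrite oner_eq0.
pose l := - (c 0 0)^-1 *: r^T.
pose g' := d + l *m r.
have dT : d^T = d.
  by rewrite /d trmx_drsub gT.
have lc : l *m c + r^T = 0.
  by rewrite [c]mx11_scalar mul_mx_scalar /l scalerA mulrN divff ?gt_eqF // scaleN1r addNr.
have g'T : g'^T = g'.
  rewrite /g' linearD /= dT trmx_mul; congr (_ + _).
  by rewrite /l -scalemxAl (linearZ _ r^T) /= trmxK -scalemxAr.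
(* The vector [row_mx (v *m l) v] is g-orthogonal to the first basis vector, by [lc], and its
   g-square is that of v under g'. *)
have g'pos (v : 'rV[R]_n) : v != 0 -> 0 < (v *m g' *m v^T) 0 0.
  move=> v0; have := gpos (row_mx (v *m l) v); rewrite gE mul_row_block.
  rewrite -mulmxA -mulmxDr lc mulmx0 tr_row_mx mul_row_col mul0mx add0r.
  rewrite -[v *m l *m r]mulmxA -mulmxDr [l *m r + d]addrC; apply.
  by rewrite row_mx_eq0 negb_and v0 orbT.
have [E' E'g] := IH g' g'T g'pos.
exists (block_mx (Num.sqrt (c 0 0))^-1%:M 0 (E' *m l) E').
rewrite {1}gE tr_block_mx !mulmx_block !trmx0 !mul0mx !mulmx0 !addr0.
have cr : c *m l^T + r = 0.
  have cT : c^T = c by rewrite [c]mx11_scalar tr_scalar_mx.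
  have -> : c *m l^T + r = (l *m c + r^T)^T by rewrite linearD /= trmx_mul trmxK cT.
  by rewrite lc trmx0.
rewrite -![E' *m l *m _]mulmxA -!mulmxDr lc mulmx0 !mul0mx add0r.
rewrite trmx_mul -[_%:M *m c *m (_ *m _)]mulmxA -[_%:M *m r *m _]mulmxA -mulmxDr.
rewrite [c *m (_ *m _)]mulmxA -mulmxDl cr mul0mx mulmx0.
rewrite [l *m r + d]addrC -/g' E'g scalar_mx_block; congr block_mx.
rewrite tr_scalar_mx mul_mx_scalar mul_scalar_mx scalerA [c]mx11_scalar scale_scalar_mx.
by rewrite -invfM [_%:M 0 0]mxE eqxx mulr1n -expr2 (sqr_sqrtr (ltW c0)) mulVf ?gt_eqF.
Qed.

(** The hypothesis says that the rows of E form a g-orthonormal frame, so [g *m E^T *m E] is the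
    identity and can be inserted under the trace before cycling. *)
Lemma mxtrace_frame (R : comNzRingType) n (E g T : 'M[R]_n) :
  E *m g *m E^T = 1%:M -> \tr T = \sum_i (row i E *m T *m g *m (row i E)^T) 0 0.
Proof.
move=> EgE; have gEE : g *m E^T *m E = 1%:M by apply: mulmx1C; rewrite mulmxA.
rewrite -[T in LHS]mulmx1 -gEE !mulmxA mxtrace_mulC !mulmxA /mxtrace; apply: eq_bigr => i _.
rewrite -!row_mul mxE [in RHS]mxE [RHS]mxE; move: (E *m T *m g) => K.
by apply: eq_bigr => j _; rewrite !mxE.
Qed.

Section SectionalBound.
Variables (R : realType) (n : nat) (M : riemannianManifold R n) (a : chart M) (x : M).
Hypothesis ax : dom a x.
Implicit Types v w : 'rV[R]_n.

Let B v w := inner a x v w.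

Let BC v w : B v w = B w v.
Proof.
rewrite /B /inner; have -> : w *m metric a x *m v^T = (v *m metric a x *m w^T)^T.
  by rewrite !trmx_mul trmxK (metric_sym (manifold_laws M) ax) mulmxA.
by rewrite [RHS]mxE.
Qed.

Let BDl u v w : B (u + v) w = B u w + B v w.
Proof. by rewrite /B /inner !mulmxDl mxE. Qed.

Let BZl (c : R) v w : B (c *: v) w = c * B v w.
Proof. by rewrite /B /inner -!scalemxAl mxE. Qed.

Let BDr u v w : B w (u + v) = B w u + B w v.
Proof. by rewrite !(BC w) BDl. Qed.

Let BZr (c : R) v w : B w (c *: v) = c * B w v.
Proof. by rewrite !(BC w) BZl. Qed.

Let curv_mxZ (c : R) v w : curv_mx a x (c *: w) v = c *: curv_mx a x w v.
Proof.
apply/matrixP => k l; rewrite (curv_mxE _ _ _ _ ax) [RHS]mxE (curv_mxE _ _ _ _ ax) mulr_sumr.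
apply: eq_bigr => i _.
by rewrite mulr_sumr; apply: eq_bigr => j _; rewrite mxE !mulrA.
Qed.

Let curv_mxx v : curv_mx a x v v = 0.
Proof. by rewrite /curv_mx !subrr add0r subrr. Qed.

(* When X and V are dependent, sectional is a division by 0, but both sides of the
   inequality vanish. *)
Lemma curvature_le (c : R) (X V : 'rV[R]_n) :
  (forall X V, row_free (col_mx X V) -> sectional a x X V <= c) ->
  (V *m curv_mx a x X V *m metric a x *m X^T) 0 0 <=
  c * (inner a x X X * inner a x V V - inner a x X V ^+ 2).
Proof.
move=> sec; rewrite -/(B X X) -/(B V V) -/(B X V).
have [->|V0] := eqVneq V 0.
  by rewrite !mul0mx /B /inner mul0mx trmx0 !mulmx0 !mxE expr2 !mulr0 subr0 mulr0.
have VV : 0 < B V V by exact: metric_pos (manifold_laws M) _ _ _ ax V0.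
(* A multiple of the component of X orthogonal to V, free of denominators; with V nonzero it
   vanishes exactly when X and V are dependent. *)
pose Z := B V V *: X + - B X V *: V.
have BVV : B V V != 0 by rewrite gt_eqF.
have [Z0|Z0] := eqVneq Z 0.
  have XE : X = (B X V / B V V) *: V.
    apply: (scalerI BVV); rewrite scalerA mulrCA divff // mulr1.
    by move/eqP: Z0; rewrite /Z scaleNr subr_eq0 => /eqP.
  rewrite {1}XE curv_mxZ curv_mxx scaler0 mulmx0 !mul0mx mxE XE.
  have -> : B ((B X V / B V V) *: V) ((B X V / B V V) *: V) * B V V -
    B ((B X V / B V V) *: V) V ^+ 2 = 0 by rewrite !BZl !BZr; ring.
  by rewrite mulr0.
(* The square of Z is [B V V] times the Gram determinant, which is therefore positive. *)
have D0 : 0 < B X X * B V V - B X V ^+ 2.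
  have : 0 < B Z Z by exact: metric_pos (manifold_laws M) _ _ _ ax Z0.
  rewrite /Z !(BDl, BDr, BZl, BZr) (BC V X).
  set s := (Y in 0 < Y -> _); have -> : s = B V V * (B X X * B V V - B X V ^+ 2).
    by rewrite /s; ring.
  by rewrite pmulr_rgt0.
have XV : row_free (col_mx X V).
  rewrite -kermx_eq0; apply/rowV0P => u /sub_kermxP.
  rewrite -[u]hsubmxK mul_row_col [lsubmx u]mx11_scalar [rsubmx u]mx11_scalar !mul_scalar_mx.
  move: (lsubmx u 0 0) (rsubmx u 0 0) => s t st.
  have s0 : s = 0.
    apply/eqP; have : s *: Z == 0.
      have sX : s *: X = - t *: V by apply/eqP; rewrite scaleNr -addr_eq0 st.
      have Bs : s * B X V = - t * B V V by rewrite -!BZl sX.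
      have -> : s *: Z = B V V *: (s *: X) + - (s * B X V) *: V.
        by rewrite /Z scalerDr !scalerA mulrN [s * B V V]mulrC.
      by rewrite sX Bs scalerA [B V V * _]mulrC scaleNr subrr.
    by rewrite scaler_eq0 (negPf Z0) orbF.
  move: st; rewrite s0 scale0r add0r => /eqP; rewrite scaler_eq0 (negPf V0) orbF => /eqP ->.
  by rewrite raddf0 row_mx0.
have := sec X V XV; rewrite /sectional ler_pdivrMr // => H; apply: le_trans H.
by rewrite /inner curvatureE.
Qed.

End SectionalBound.

(* R(X + x0 d_t, V + v0 d_t) applied to V + v0 d_t, paired with X + x0 d_t. *)
Lemma warped_quad (R : realType) n (G C : 'M[R]_n) (X V : 'rV[R]_n) (x0 v0 f0 f1 f2 : R) :
  let b (Y Z : 'rV[R]_n) := (Y *m G *m Z^T) 0 0 in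
  let Z := x0 *: V - v0 *: X in
  f0 != 0 -> G^T = G ->
  ((row_mx v0%:M V : 'rV[R]_(1 + n)) *m
    block_mx 0 (f2 / f0 *: Z) (- (f0 * f2) *: (G *m Z^T))
      (C + f1 ^+ 2 *: (G *m (X^T *m V - V^T *m X)))
    *m block_mx 1%:M 0 0 (f0 ^+ 2 *: G) *m (row_mx x0%:M X)^T) 0 0 =
  f0 ^+ 2 * ((V *m C *m G *m X^T) 0 0 - (f1 ^+ 2 - f0 * f2) * (b X X * b V V - b X V ^+ 2))
  - f2 / f0 * ((v0 ^+ 2 + f0 ^+ 2 * b V V) * (x0 ^+ 2 + f0 ^+ 2 * b X X)
               - (v0 * x0 + f0 ^+ 2 * b X V) ^+ 2).
Proof.
move=> b Z f00 GT.
have bC Y W : b W Y = b Y W.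
  rewrite /b; have -> : Y *m G *m W^T = (W *m G *m Y^T)^T by rewrite !trmx_mul trmxK GT mulmxA.
  by rewrite [RHS]mxE.
have m11 (W W' : 'M[R]_1) : (W *m W') 0 0 = W 0 0 * W' 0 0 by rewrite mxE big_ord1.
have trZ m1 m2 (c : R) (W : 'M[R]_(m1, m2)) : (c *: W)^T = c *: W^T by exact: linearZ.
have trB m1 m2 (W W' : 'M[R]_(m1, m2)) : (W - W')^T = W^T - W'^T by exact: linearB.
rewrite tr_row_mx tr_scalar_mx !mul_row_block mul_row_col !mulmx0 !mulmx1 !(add0r, addr0).
rewrite /Z !(trB, trZ, mulmxBr, mulmxBl, mulmxDr, mulmxDl, scalerBr, scalerDr).
rewrite -?(scalemxAr, scalemxAl) ?mulmxA.
rewrite ?(mulmxBl, mulmxDl, mulmxN, mulNmx) ?mulmxA ?mulNmx.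
rewrite ?mul_scalar_mx ?mul_mx_scalar -?scalemxAr -?scalemxAl.
have -> : V *m G *m X^T *m V *m G *m X^T = (V *m G *m X^T) *m (V *m G *m X^T).
  by rewrite !mulmxA.
have -> : V *m G *m V^T *m X *m G *m X^T = (V *m G *m V^T) *m (X *m G *m X^T).
  by rewrite !mulmxA.
rewrite (bC V X) /b; move: (V *m G *m X^T) (V *m G *m V^T) (X *m G *m X^T) (V *m C *m G *m X^T).
move=> k1 k2 k3 k4; rewrite !mxE !big_ord1.
by field.
Qed.

(** * Hypersurfaces of the warped product *)

Section HypersurfaceInWarped.
Variables (R : realType) (n : nat) (I : set R) (f : R -> R).
Variables (M Sigma : riemannianManifold R n) (phi : Sigma -> warped I f M).
Variables (nu : chart (warped I f M) -> Sigma -> 'rV[R]_(1 + n)).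
Variable A : chart Sigma -> Sigma -> 'M[R]_n.
Hypothesis I_open : open I.
Hypothesis f_smooth : forall (k : nat) (t : R), I t -> derivable (derive1n k f) t 1.
Hypothesis f_pos : forall t : R, I t -> 0 < f t.
Hypothesis phi_isometric : isometric_immersion phi.
Hypothesis nu_normal : unit_normal phi nu.
Hypothesis A_shape : shape_operator phi nu A.

Let h (q : Sigma) : R := (phi q).1.
Let psi (q : Sigma) : M := (phi q).2.
Hypothesis h_smooth : smooth_fun h.

Variables (a : chart Sigma) (b : chart M).
Let b' : chart (warped I f M) := b.
Let U : set Sigma := [set q | dom a q /\ dom b' (phi q)].
Implicit Types (v w : 'rV[R]_n) (p q : Sigma).

Let phi_cont : continuous phi. Proof. by case: phi_isometric => -[]. Qed.

Let psi_cont : continuous psi.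
Proof. by move=> q; apply: continuous_comp; [exact: phi_cont|exact: cvg_snd]. Qed.

Let h_cont : continuous h.
Proof. by move=> q; apply: continuous_comp; [exact: phi_cont|exact: cvg_fst]. Qed.

Let openU : open U.
Proof.
have -> : U = dom a `&` (h @^-1` I `&` psi @^-1` dom b) by [].
apply: openI; first exact: chart_open (manifold_laws Sigma) a.
apply: openI; first by apply: open_comp => // q _; exact: h_cont.
apply: open_comp => [q _|]; first exact: psi_cont.
exact: chart_open (manifold_laws M) b.
Qed.

Let domU q : U q -> dom a q. Proof. by case. Qed.
Let psi_dom q : U q -> dom b (psi q). Proof. by case=> _ []. Qed.
Let IU q : U q -> I (h q). Proof. by case=> _ []. Qed.
Let f_derivable q : U q -> derivable f (h q) 1.
Proof. by move=> /IU Ih; exact (@f_smooth 0%N _ Ih). Qed.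
Let df_derivable q : U q -> derivable (derive1 f) (h q) 1.
Proof. by move=> /IU Ih; exact (@f_smooth 1%N _ Ih). Qed.
Let f_neq0 q : U q -> f (h q) != 0. Proof. by move=> /IU /f_pos; rewrite lt0r => /andP[]. Qed.

Let c (j : 'I_(1 + n)) (q : Sigma) : R := coord b' (phi q) 0 j.

Let c_smooth j : smooth_in a U (c j).
Proof.
case: phi_isometric => -[_ _ phi_smooth] _ s q aq [_ bq].
exact: (phi_smooth a b' j s q aq bq).
Qed.

Let psi_smooth j : smooth_in a U (fun q => coord b (psi q) 0 j).
Proof.
have := c_smooth (rshift 1 j); congr (smooth_in a U _).
by apply/funext => q; rewrite /c /= row_mxEr.
Qed.

Let hU_smooth : smooth_in a U h.
Proof. by move=> s q aq _; exact: h_smooth. Qed.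

Let P : Sigma -> 'M[R]_(n, 1 + n) := dmap a b' phi.
Let J : Sigma -> 'M[R]_n := dmap a b psi.
Let om := wconn psi h f a b.

Let dphiE v q : U q -> v *m P q = row_mx (dd a v h q)%:M (v *m J q).
Proof.
move=> Uq; have aq := domU Uq; apply/rowP => j; rewrite (jac_row openU c_smooth v j aq Uq).
case: (split_ordP j) => i ->.
  rewrite ord1 row_mxEl mxE eqxx mulr1n; congr (dd a v _ q).
  by apply/funext => q'; rewrite /c /= row_mxEl mxE eqxx mulr1n.
rewrite row_mxEr (jac_row openU psi_smooth v i aq Uq); congr (dd a v _ q).
by apply/funext => q'; rewrite /c /= row_mxEr.
Qed.

Let P_diff q : U q -> mdiff a q P.
Proof. by move=> Uq; exact: (jac_mdiff openU c_smooth (domU Uq) Uq). Qed.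

Let dP_diff q v : U q -> mdiff a q (fun q' => dm a q' v P).
Proof. by move=> Uq; exact: (dm_jac_mdiff openU c_smooth v (domU Uq) Uq). Qed.

Let G := wmetric psi h f b.

Let G_diff q : U q -> mdiff a q G.
Proof.
move=> Uq; exact: (wmetric_mdiff openU psi_cont psi_dom psi_smooth hU_smooth f_derivable (domU Uq) Uq).
Qed.

Let nu_diff q : U q -> mdiff a q (nu b').
Proof.
move=> Uq i j; rewrite ord1.
have sn : smooth_in a U (fun q => nu b' q 0 j).
  move=> s q' aq' [_ bq']; exact: (@normal_smooth _ _ _ _ _ _ nu_normal a b' j s q' aq' bq').
exact: (smooth_pdiff [::] openU sn (domU Uq) Uq).
Qed.

Let om_diff q v : U q -> mdiff a q (om v).
Proof.
by move=> Uq; exact: (wconn_mdiff openU psi_cont psi_dom psi_smooth hU_smooth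
  f_derivable df_derivable f_neq0 (domU Uq) Uq).
Qed.

Let dPC q v w : U q ->
  dm a q w (fun q' => dm a q' v P) = dm a q v (fun q' => dm a q' w P).
Proof. by move=> Uq; exact: (dm_jacC openU c_smooth v w (domU Uq) Uq). Qed.

Let GT q : U q -> (G q)^T = G q.
Proof. by move=> Uq; exact: (wmetricT h f psi_dom Uq). Qed.

Let PGP q : U q -> P q *m G q *m (P q)^T = metric a q.
Proof. by case=> aq bq; case: phi_isometric => _ /(_ a b' q aq bq)[_ <-]. Qed.

Let PGnu q : U q -> P q *m G q *m (nu b' q)^T = 0.
Proof.
case=> aq bq; apply/matrixP => i j; rewrite ord1 [RHS]mxE.
have := normal_orth nu_normal (delta_mx 0 i : 'rV[R]_n) aq bq.
by rewrite /inner -!mulmxA -rowE mulmxA [X in X = _]mxE.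
Qed.

Let nuGnu q : U q -> nu b' q *m G q *m (nu b' q)^T = 1%:M.
Proof.
case=> aq bq; rewrite [LHS]mx11_scalar; congr (_%:M).
exact: (normal_unit nu_normal bq).
Qed.

Let G_compat q v : U q -> dm a q v G = om v q *m G q + G q *m (om v q)^T.
Proof.
by move=> Uq; exact: (wconn_compat openU psi_cont psi_dom psi_smooth hU_smooth
  f_derivable f_neq0 (domU Uq) Uq).
Qed.

(** Ties [wconn] to the Christoffel symbols of [warped], in which [cov_deriv], and hence the shape
    operator, is stated. *)
Let om_christoffel v q : U q ->
  om v q = \sum_k (v *m P q) 0 k *: christoffel_mx b' (phi q) k.
Proof.
move=> Uq; rewrite (dphiE v Uq).
have -> : phi q = ((h q, psi q) : warped I f M) by rewrite [LHS]surjective_pairing.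
symmetry; exact: (sum_christoffel_warped I (psi_dom Uq) (f_neq0 Uq) (f_derivable Uq)).
Qed.

Let hess_map_sym q v w : U q -> w *m hess_map a P om v q = v *m hess_map a P om w q.
Proof.
move=> Uq; have aq := domU Uq; rewrite /hess_map !mulmxDr.
rewrite (dm_jac_sym openU c_smooth v w aq Uq); congr (_ + _).
rewrite !mulmxA (dphiE v Uq) (dphiE w Uq) /om /wconn !mul_row_block !mulmx0 !add0r.
have g0 : (metric b (psi q))^T = metric b (psi q) := metric_sym (manifold_laws M) (psi_dom Uq).
congr row_mx.
  rewrite -!scalemxAr; congr (_ *: _).
  have -> : v *m J q *m (metric b (psi q) *m (w *m J q)^T) =
      (w *m J q *m (metric b (psi q) *m (v *m J q)^T))^T.
    by rewrite !trmx_mul !trmxK g0 !mulmxA.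
  by move: (w *m J q *m _) => K; rewrite [K]mx11_scalar tr_scalar_mx.
have := pconn_sym a psi_dom v w Uq; rewrite -/J.
move: (w *m J q) (v *m J q) (pconn psi a b v q) (pconn psi a b w q) => W V p1 p2 WV.
rewrite !mulmxDr WV !addrA !mul_mx_scalar !mul_scalar_mx !scalerA; congr (_ + _).
by rewrite addrC; congr (_ *: _ + _ *: _); rewrite mulrC.
Qed.

Let weingarten q v : U q ->
  dm a q v (nu b') + nu b' q *m om v q = - (v *m A a q *m P q).
Proof.
move=> Uq; have [aq bq] := Uq.
rewrite -mulmxA (A_shape aq bq) mulmxN opprK om_christoffel //.
apply/rowP => j; rewrite mxE dmE [RHS]mxE.
have E i : cov_deriv phi nu a b' q i j = pd a i (fun q => nu b' q 0 j) q +
    (nu b' q *m \sum_k P q i k *: christoffel_mx b' (phi q) k) 0 j.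
  rewrite mxE; congr (_ + _); rewrite exchange_big [RHS]mxE; apply: eq_bigr => k _.
  rewrite summxE mulr_sumr; apply: eq_bigr => l _.
  by rewrite [(_ *: christoffel_mx _ _ _) k j]mxE [christoffel_mx _ _ _ k j]mxE; ring.
under [RHS]eq_bigr do rewrite E mulrDr.
rewrite big_split /=; congr (_ + _).
  exact: (dd_coord v (nu_diff Uq 0 j)).
rewrite mulmx_sumr summxE.
under [RHS]eq_bigr do rewrite mulmx_sumr summxE mulr_sumr.
rewrite exchange_big; apply: eq_bigr => k _; rewrite -scalemxAr mxE [(v *m P q) 0 k]mxE mulr_suml.
by apply: eq_bigr => i _; rewrite -scalemxAr [in RHS]mxE mulrA.
Qed.

Let second_formA v q : U q ->
  second_form a P G (nu b') om v q = metric a q *m (v *m A a q)^T.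
Proof.
exact: (second_formE openU domU P_diff G_diff nu_diff PGP PGnu G_compat weingarten).
Qed.

Let ip q v w : R := (v *m metric a q *m w^T) 0 0.

Let ipC q v w : U q -> ip q v w = ip q w v.
Proof.
move=> [aq _]; rewrite /ip; have -> : v *m metric a q *m w^T = (w *m metric a q *m v^T)^T.
  by rewrite !trmx_mul trmxK (metric_sym (manifold_laws Sigma) aq) mulmxA.
by rewrite mxE.
Qed.

Let ip_split q v w : U q -> ip q v w = dd a v h q * dd a w h q +
  f (h q) ^+ 2 * (v *m J q *m metric b (psi q) *m (w *m J q)^T) 0 0.
Proof.
move=> Uq; rewrite /ip -(PGP Uq).
have -> : v *m (P q *m G q *m (P q)^T) *m w^T = (v *m P q) *m G q *m (w *m P q)^T.
  by rewrite trmx_mul !mulmxA.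
rewrite (dphiE v Uq) (dphiE w Uq).
move: (v *m J q) (w *m J q) => V W; rewrite tr_row_mx /G /wmetric mul_row_block mul_row_col.
rewrite !mulmx0 mulmx1 addr0 add0r tr_scalar_mx mul_scalar_mx scale_scalar_mx.
by rewrite -scalemxAr -scalemxAl mxE mxE eqxx mulr1n [X in _ + X]mxE.
Qed.

Let dphi0 q i : P q i (lshift n 0) = pd a i h q.
Proof.
rewrite mxE; congr (pd a i _ q); apply/funext => q'.
by rewrite /= row_mxEl mxE eqxx mulr1n.
Qed.

(** This is the d_t component of the Gauss formula contracted with v: the first column of P is dh
    and that of nu is the angle function. The connection contributes -f f' g_M, rewritten by
    [ip_split] as -(f'/f) times the metric minus dh^2. *)
Lemma hess_height q v : U q -> (v *m hess a h q *m v^T) 0 0 =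
  derive1 f (h q) / f (h q) * (ip q v v - dd a v h q ^+ 2)
  + nu b' q 0 (lshift n 0) * ip q (v *m A a q) v.
Proof.
move=> Uq; have aq := domU Uq; have f0 := f_neq0 Uq.
have GF := gauss_formula openU domU P_diff G_diff GT PGP PGnu nuGnu G_compat hess_map_sym v Uq.
rewrite /hess_map second_formA // in GF.
have := congr1 (fun W => (v *m W) 0 (lshift n 0)) GF.
rewrite !mulmxDr [LHS]mxE [RHS]mxE !(mulmxA v) (dphiE v Uq).
have -> : (row_mx (dd a v h q)%:M (v *m J q) *m om v q) 0 (lshift n 0) =
    - (derive1 f (h q) / f (h q) * (ip q v v - dd a v h q ^+ 2)).
  rewrite ip_split // /om /wconn mul_row_block row_mxEl mulmx0 add0r -scalemxAr mxE.
  by rewrite mulmxA; field.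
have -> : (v *m metric a q *m (v *m A a q)^T *m nu b' q) 0 (lshift n 0) =
    nu b' q 0 (lshift n 0) * ip q (v *m A a q) v.
  by rewrite ipC // /ip mxE big_ord1 mulrC.
have -> : (v *m dm a q v P) 0 (lshift n 0) =
    \sum_i \sum_j v 0 j * pd a j (pd a i h) q * v 0 i.
  rewrite mxE; apply: eq_bigr => i _; rewrite dmE.
  under [F in dd a v F q]eq_fun do rewrite dphi0.
  rewrite dd_coord; last exact: (smooth_pdiff [:: i] openU hU_smooth aq Uq).
  by rewrite mulrC mulr_suml.
have -> : (v *m conn a q v *m P q) 0 (lshift n 0) =
    \sum_i \sum_j v 0 j * (\sum_k christoffel a k j i q * pd a k h q) * v 0 i.
  rewrite mxE; under eq_bigr do rewrite dphi0 mxE mulr_suml.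
  rewrite exchange_big; apply: eq_bigr => i _ /=.
  rewrite /conn; under eq_bigr do rewrite summxE mulr_sumr mulr_suml.
  rewrite exchange_big; apply: eq_bigr => j _ /=; rewrite mulr_sumr mulr_suml.
  apply: eq_bigr => k _.
  by rewrite [(_ *: christoffel_mx _ _ _) i k]mxE [christoffel_mx _ _ _ i k]mxE; ring.
have -> : (v *m hess a h q *m v^T) 0 0 =
    \sum_i \sum_j v 0 j * pd a j (pd a i h) q * v 0 i
    - \sum_i \sum_j v 0 j * (\sum_k christoffel a k j i q * pd a k h q) * v 0 i.
  rewrite mxE -sumrN -big_split; apply: eq_bigr => i _ /=.
  rewrite mxE [v^T i 0]mxE mulr_suml -sumrN -big_split; apply: eq_bigr => j _ /=.
  by rewrite mxE; ring.
by move=> E; lra.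
Qed.

Hypothesis M_curvature : forall (x : M) (X V : 'rV[R]_n) (t : R), dom b x -> I t ->
  row_free (col_mx X V) ->
  sectional b x X V <= derive1 f t ^+ 2 - f t * derive1 (derive1 f) t.

Let F q : R := derive1 (derive1 f) (h q) / f (h q).

(** In [warped_quad] the f^2 term is nonpositive by the bound on the fiber, taken at t = h(q). By
    [ip_split] the factor of -f''/f is the Gram determinant of v and w in the induced metric. *)
Let ambient_curv_le q v w : U q ->
  (v *m (P q *m (dm a q w (om v) - dm a q v (om w) + om v q *m om w q - om w q *m om v q)
     *m (G q *m (P q)^T)) *m w^T) 0 0 <= - (F q * (ip q v v * ip q w w - ip q v w ^+ 2)).
Proof.
move=> Uq; have aq := domU Uq; have bq := psi_dom Uq.
rewrite (wconn_curv openU psi_cont psi_dom psi_smooth hU_smooth f_derivable df_derivable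
  f_neq0 aq Uq v w) /=.
set Phi := block_mx _ _ _ _.
have -> : v *m (P q *m Phi *m (G q *m (P q)^T)) *m w^T =
    (v *m P q) *m Phi *m G q *m (w *m P q)^T by rewrite trmx_mul !mulmxA.
rewrite (dphiE v Uq) (dphiE w Uq) /Phi /G /wmetric.
have GMT : (metric b (psi q))^T = metric b (psi q) := metric_sym (manifold_laws M) bq.
rewrite (@warped_quad _ _ _ _ _ _ _ _ _ _ _ (f_neq0 Uq) GMT) !ip_split // -!expr2.
rewrite -[leRHS]add0r; apply: lerD; last first.
  have -> : (w *m J q *m metric b (psi q) *m (v *m J q)^T) 0 0 =
      (v *m J q *m metric b (psi q) *m (w *m J q)^T) 0 0.
    have -> : w *m J q *m metric b (psi q) *m (v *m J q)^T =
        (v *m J q *m metric b (psi q) *m (w *m J q)^T)^T.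
      by rewrite [RHS]trmx_mul trmxK [(_ *m metric b _)^T]trmx_mul GMT mulmxA.
    by rewrite [LHS]mxE.
  exact: lexx.
apply: mulr_ge0_le0; first exact: sqr_ge0.
rewrite subr_le0.
have H := @curvature_le _ _ M b (psi q) bq
  (derive1 f (h q) ^+ 2 - f (h q) * derive1 (derive1 f) (h q)) (w *m J q) (v *m J q)
  (fun X V => @M_curvature _ X V _ bq (IU Uq)).
exact: H.
Qed.

(** Self-adjointness of A, read off by pairing the symmetry of [hess_map] with nu. *)
Let second_form_sym q v w : U q -> ip q (w *m A a q) v = ip q (v *m A a q) w.
Proof.
move=> Uq; have := congr1 (fun W => (W *m G q *m (nu b' q)^T) 0 0) (hess_map_sym v w Uq).
rewrite -!mulmxA !(mulmxA (hess_map _ _ _ _ _)) -!/(second_form _ _ _ _ _ _ _).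
rewrite !second_formA // !mulmxA => E.
by rewrite ipC // [RHS]ipC // /ip -E.
Qed.

Let second_form_term q v w : U q ->
  (v *m ((second_form a P G (nu b') om v q *m (w *m A a q)
    - second_form a P G (nu b') om w q *m (v *m A a q)) *m metric a q) *m w^T) 0 0 =
  ip q (v *m A a q) v * ip q (w *m A a q) w - ip q (w *m A a q) v * ip q (v *m A a q) w.
Proof.
move=> Uq; rewrite !second_formA // [X in _ = X * _ - _]ipC // [X in _ = _ - X * _]ipC // /ip.
move: (v *m A a q) (w *m A a q) (metric a q) => V W g.
have m11 (Y Z : 'M[R]_1) : Y 0 0 * Z 0 0 = (Y *m Z) 0 0 by rewrite mxE big_ord1.
by rewrite !m11 mulmxBl mulmxBr mulmxBl !mulmxA mxE [X in _ + X]mxE.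
Qed.

Let curv_le q v w : U q ->
  (v *m curv_mx a q w v *m metric a q *m w^T) 0 0 <=
  - (F q * (ip q v v * ip q w w - ip q v w ^+ 2))
  + (ip q (v *m A a q) v * ip q (w *m A a q) w - ip q (w *m A a q) v * ip q (v *m A a q) w).
Proof.
move=> Uq.
have := gauss_equation openU domU P_diff dP_diff G_diff nu_diff om_diff dPC GT PGP PGnu
    nuGnu G_compat hess_map_sym weingarten v w Uq.
have := ambient_curv_le v w Uq; have := second_form_term v w Uq.
move: (P q *m _ *m _) ((_ - _) *m metric a q) => K D DE Kle KE.
have CE : curv_mx a q w v *m metric a q = K + D by rewrite KE subrK.
rewrite -(mulmxA v) CE mulmxDr mulmxDl mxE DE.
exact: lerD Kle (lexx _).
Qed.

(** Sum [curv_le] over an orthonormal frame. Self-adjointness and the eigenvector equation turn the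
    cross terms into rho^2 times the squared coefficients of v. The frame is arbitrary rather than
    adapted to v, so v = 0 is no exception; the factor n-1 comes from n copies of the square of v
    less the Parseval sum. *)
Lemma ricci_le q v (rho : R) : U q -> v *m A a q = rho *: v ->
  (v *m ricci a q *m v^T) 0 0 <=
  - ((n%:R - 1) * F q * ip q v v) + rho * ip q v v * \tr (A a q) - rho ^+ 2 * ip q v v.
Proof.
move=> Uq vA; have aq := domU Uq.
have gT : (metric a q)^T = metric a q := metric_sym (manifold_laws Sigma) aq.
have [E EgE] : exists E : 'M[R]_n, E *m metric a q *m E^T = 1%:M.
  by apply: orthonormal_frame gT _ => w w0; exact: metric_pos (manifold_laws Sigma) _ _ _ aq w0.
rewrite (ricciE v aq) (mxtrace_frame _ EgE) (mxtrace_frame (A a q) EgE).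
pose e i := row i E.
have ipZ c0 x y : ip q (c0 *: x) y = c0 * ip q x y by rewrite /ip -!scalemxAl mxE.
have term i : (e i *m jacobi_mx a q v *m metric a q *m (e i)^T) 0 0 <=
    - (F q * (ip q v v - ip q v (e i) ^+ 2))
    + (rho * ip q v v * ip q (e i *m A a q) (e i) - rho ^+ 2 * ip q v (e i) ^+ 2).
  rewrite (jacobi_mxE v (e i) aq); apply: le_trans (curv_le v (e i) Uq) _.
  have -> : ip q (e i) (e i) = 1.
    have := congr1 (fun W : 'M[R]_n => W i i) EgE.
    rewrite [RHS]mxE eqxx mulr1n => <-; rewrite /ip /e -!row_mul mxE [LHS]mxE [RHS]mxE.
    by move: (E *m _) => W; apply: eq_bigr => j _; rewrite !mxE.
  have -> : ip q (e i *m A a q) v = rho * ip q v (e i).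
    by rewrite second_form_sym // vA ipZ.
  by rewrite vA !ipZ mulr1 le_eqVlt; apply/orP; left; apply/eqP; ring.
(* Parseval's identity: E^T E is the inverse metric. *)
have sq : \sum_i ip q v (e i) ^+ 2 = ip q v v.
  have gEE : metric a q *m E^T *m E = 1%:M by apply: mulmx1C; rewrite mulmxA.
  transitivity ((v *m metric a q *m E^T *m (v *m metric a q *m E^T)^T) 0 0); last first.
    have -> : v *m metric a q *m E^T *m (v *m metric a q *m E^T)^T =
        v *m (metric a q *m E^T *m E) *m (metric a q *m v^T).
      by rewrite !trmx_mul trmxK gT !mulmxA.
    by rewrite gEE mulmx1 mulmxA.
  rewrite mxE; apply: eq_bigr => i _; rewrite [_^T i 0]mxE -expr2; congr (_ ^+ 2).
  by rewrite /ip mxE [RHS]mxE; apply: eq_bigr => j _; rewrite !mxE.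
apply: le_trans (ler_sum _ (fun i _ => term i)) _.
rewrite big_split /= sumrN -mulr_sumr sumrB sq big_split /= sumrN -!mulr_sumr sq.
rewrite sumr_const card_ord -mulr_natl.
by rewrite le_eqVlt; apply/orP; left; apply/eqP; ring.
Qed.

End HypersurfaceInWarped.

(** * Vanishing gradient and conclusion *)

(** A function with vanishing partial derivatives is constant on a coordinate ball, so its level
    sets are open as well as closed. *)
Lemma dfun0_const (R : realType) (n : nat) (X : riemannianManifold R n) (h : X -> R) :
  connected [set: X] -> smooth_fun h ->
  (forall (a : chart X) p, dom a p -> dfun a h p = 0) -> exists c : R, forall p, h p = c.
Proof.
move=> conn_X h_smooth dh0.
have h_cont : continuous h.
  move=> p; have [a ap] := chart_cover (manifold_laws X) p.
  by have [] := h_smooth a [::] p ap I.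
have h_loc p : \forall q \near p, h q = h p.
  have [a ap] := chart_cover (manifold_laws X) p.
  have D0 : \forall y \near coord a p, coord a (param a y) = y /\ dom a (param a y).
    by apply: filterI; [exact: near_coordK|exact: near_param (near_dom ap)].
  have D i y : coord a (param a y) = y -> dom a (param a y) ->
      derivable (h \o param a) y (delta_mx 0 i) /\ 'D_(delta_mx 0 i) (h \o param a) y = 0.
    move=> ya ay; have [_ /(_ i)] := h_smooth a [::] _ ay I; rewrite ya => dy; split; first exact: dy.
    by have /rowP/(_ i) := dh0 a _ ay; rewrite !mxE /pd ya.
  move: D0 => /nbhs_ballP[r /= r0 rD].
  have rDx y : `|y - coord a p| < r -> coord a (param a y) = y /\ dom a (param a y).
    by move=> yr; apply: rD; rewrite mx_norm_ball /ball_ /= distrC.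
  have pa := chart_cancel (manifold_laws X) ap.
  have Fc y : `|y - coord a p| < r -> h (param a y) = h p.
    (* With all partial derivatives zero, [increment_le] applies with error bound 0. *)
    move=> yr; have := @increment_le _ _ (h \o param a) (coord a p) (y - coord a p) r 0 yr.
    rewrite addrCA subrr addr0 /= pa big1 => [H|i _]; last first.
      by have [||_ ->] := D i (coord a p); rewrite ?pa ?mulr0.
    apply/eqP; rewrite -subr_eq0 -normr_le0.
    have {}H := H _; rewrite subr0 mul0r mulr0 in H; apply: H => z i zr.
    have [zK az] := rDx z zr; have [dz ->] := D i z zK az; split; first exact: dz.
    by have [||_ ->] := D i (coord a p); rewrite ?pa ?subrr ?normr0.
  have : \forall q \near p, dom a q /\ `|coord a q - coord a p| < r.
    apply: filterI; first exact: near_dom.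
    apply: (near_coord (P := fun y => `|y - coord a p| < r) ap).
    by apply/nbhs_ballP; exists r => // y; rewrite mx_norm_ball /ball_ /= distrC.
  apply: filterS => q [aq qr].
  by rewrite -[in LHS](chart_cancel (manifold_laws X) aq) Fc.
(* If there are no points, any constant will do. *)
have [[p0 _]|no] := pselect (exists p : X, True); last first.
  by exists 0 => p; case: no; exists p.
exists (h p0).
have : [set q | h q = h p0] = [set: X].
  apply: conn_X.
  - by exists p0.
  - exists [set q | h q = h p0]; last by rewrite setTI.
    rewrite openE => q /= hq; rewrite /interior.
    by have := h_loc q; apply: filterS => q' /= ->.
  - exists [set q | h q = h p0]; last by rewrite setTI.
    apply: (@closed_comp _ _ h [set h p0]) => [q _|]; first exact: h_cont.
    exact: closed_eq.
by move=> /seteqP[_ H] p; exact: (H p I).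
Qed.

(** Four times the polynomial is b^2 + 4 k - (2 x - b)^2. If the discriminant is positive, the
    polynomial is minus the product of the distances, with sign, from x to the two roots, and x lies
    outside the open interval between them. *)
Lemma quadratic_le0 (R : rcfType) (x b k : R) :
  b ^+ 2 + 4 * k <= 0 \/
  0 < b ^+ 2 + 4 * k /\ (x <= (b - Num.sqrt (b ^+ 2 + 4 * k)) / 2 \/
                         (b + Num.sqrt (b ^+ 2 + 4 * k)) / 2 <= x) ->
  - x ^+ 2 + b * x + k <= 0.
Proof.
case=> [D0|[D0 xD]]; first by have := sqr_ge0 (2 * x - b); nra.
have := sqr_sqrtr (ltW D0); have := sqrtr_ge0 (b ^+ 2 + 4 * k).
move: (Num.sqrt _) xD => d xD d0 d2.
suff : 0 <= (x - (b - d) / 2) * (x - (b + d) / 2) by nra.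
by case: xD => xd; [apply: mulr_le0|apply: mulr_ge0]; lra.
Qed.

Theorem theorem4p13 (R : realType) (n m : nat)
  (I : set R) (f : R -> R) (M : riemannianManifold R n)
  (Sigma : riemannianManifold R n) (N : riemannianManifold R m)
  (alpha : R) (h : Sigma -> R) (u : Sigma -> N) (mu lam : Sigma -> R)
  (phi : Sigma -> warped I f M)
  (nu : chart (warped I f M) -> Sigma -> 'rV[R]_(1 + n))
  (A : chart Sigma -> Sigma -> 'M[R]_n) (H theta rho : Sigma -> R)
  (I_open : open I) (I_interval : is_interval I)
  (f_smooth : forall (k : nat) (t : R), I t -> derivable (derive1n k f) t 1)
  (f_pos : forall t : R, I t -> 0 < f t)
  (M_connected : connected [set: M]) (M_oriented : oriented_atlas M)
  (M_curvature : forall (a : chart M) (x : M) (U V : 'rV[R]_n),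
     dom a x -> row_free (col_mx U V) ->
     ((sectional a x U V)%:E <=
       ereal_inf [set (derive1 f t ^+ 2 - f t * derive1n 2 f t)%:E | t in I])%E)
  (Sigma_einstein : einstein_type alpha h u mu lam)
  (Sigma_noncompact : ~ compact [set: Sigma])
  (phi_isometric : isometric_immersion phi)
  (h_def : forall p : Sigma, h p = (phi p).1)
  (mu_bound : forall p : Sigma, mu p > - (derive1 f (h p) / f (h p)))
  (nu_normal : unit_normal phi nu)
  (A_shape : shape_operator phi nu A)
  (H_def : forall (a : chart Sigma) (p : Sigma), dom a p -> n%:R * H p = \tr (A a p))
  (theta_def : forall (b : chart (warped I f M)) (p : Sigma), dom b (phi p) ->
     theta p = inner b (phi p) (nu b p) (partial_t R n))
  (rho_smooth : smooth_fun rho)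
  (rho_eigen : forall (a : chart Sigma) (p : Sigma), dom a p ->
     grad a h p *m A a p = rho p *: grad a h p) :
  let Delta (p : Sigma) :=
    (n%:R * H p + theta p) ^+ 2 +
    4 * (derive1 f (h p) / f (h p) - (n%:R - 1) * (derive1n 2 f (h p) / f (h p))
         - lam p) in
  ((forall p : Sigma, Delta p <= 0) -> einstein_harmonic h) /\
  ((forall p : Sigma, 0 < Delta p) ->
   (forall p : Sigma, rho p <= (n%:R * H p + theta p - Num.sqrt (Delta p)) / 2 \/
                  (n%:R * H p + theta p + Num.sqrt (Delta p)) / 2 <= rho p) ->
   einstein_harmonic h).
Proof.
have hE : h = (fun q => (phi q).1) by apply/funext => q; exact: h_def.
subst h; set h := (fun q => (phi q).1) in Sigma_einstein mu_bound rho_eigen h_def *.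
(* Both statements reduce to this pointwise claim; they differ only in how the sign of the quadratic
   in rho is obtained. *)
have key p : - rho p ^+ 2 + (n%:R * H p + theta p) * rho p
    + (derive1 f (h p) / f (h p) - (n%:R - 1) * (derive1n 2 f (h p) / f (h p)) - lam p) <= 0 ->
    forall a : chart Sigma, dom a p -> dfun a h p = 0.
  move=> bracket a ap.
  have [b bp] : exists b : chart M, dom (b : chart (warped I f M)) (phi p).
    by case: phi_isometric => -[_ /(_ p) [b bp] _] _; exists b.
  have [b1 bp1] : exists b1 : chart N, dom b1 (u p).
    by case: (einstein_u Sigma_einstein) => _ /(_ p).
  have Up : dom a p /\ dom (b : chart (warped I f M)) (phi p) by [].
  have h_smooth := einstein_h Sigma_einstein.
  set v := grad a h p.
  have gU := metric_unitmx ap.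
  have vg : v *m metric a p = dfun a h p by rewrite /v /grad mulmxKV.
  have vA : v *m A a p = rho p *: v by exact: rho_eigen.
  move: v vg vA => v vg vA.
  pose s : R := (v *m metric a p *m v^T) 0 0.
  have s_ge0 : 0 <= s by exact: (inner_ge0 ap v).
  have dhv : dd a v h p = s.
    rewrite (dd_coord v (smooth_pdiff [::] openT (h_smooth a) ap Logic.I)).
    by rewrite /s vg mxE; apply: eq_bigr => i _; rewrite !mxE mulrC.
  have vAv : (v *m A a p *m metric a p *m v^T) 0 0 = rho p * s.
    by rewrite vA -!scalemxAl mxE.
  have sec x X V t : dom b x -> I t -> row_free (col_mx X V) ->
      sectional b x X V <= derive1 f t ^+ 2 - f t * derive1 (derive1 f) t.
    move=> bx It XV; rewrite -lee_fin; apply: le_trans (M_curvature b x X V bx XV) _.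
    by apply: ereal_inf_lbound; exists t.
  have Ric : (v *m ricci a p *m v^T) 0 0 <=
      - ((n%:R - 1) * (derive1n 2 f (h p) / f (h p)) * s) + rho p * s * \tr (A a p) - rho p ^+ 2 * s.
    exact: (ricci_le I_open f_smooth f_pos phi_isometric nu_normal A_shape h_smooth sec Up vA).
  (* In the product metric d_t is a unit vector orthogonal to the fiber, so pairing with it reads
     off the first component of nu. *)
  have thetaE : theta p = nu b p 0 (lshift n 0).
    rewrite (theta_def b p bp) /inner /= /partial_t -[nu b p]hsubmxK.
    rewrite mul_row_block tr_row_mx mul_row_col !mulmx0 !mulmx1 trmx1 trmx0 mulmx0 !addr0 mulmx1.
    by rewrite row_mxEl.
  have Hess : (v *m hess a h p *m v^T) 0 0 =
      derive1 f (h p) / f (h p) * (s - s ^+ 2) + theta p * (rho p * s).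
    rewrite (hess_height I_open f_smooth f_pos phi_isometric nu_normal A_shape h_smooth v Up).
    by rewrite -/h dhv thetaE -vAv.
  have pos : 0 <= (v *m pullback a b1 u p *m v^T) 0 0.
    have -> : v *m pullback a b1 u p *m v^T =
        (v *m dmap a b1 u p) *m metric b1 (u p) *m (v *m dmap a b1 u p)^T.
      by rewrite /pullback trmx_mul !mulmxA.
    exact: (inner_ge0 bp1).
  have alpha_pos := mulr_ge0 (ltW (einstein_alpha Sigma_einstein)) pos.
  have dh2 : (v *m ((dfun a h p)^T *m dfun a h p) *m v^T) 0 0 = s ^+ 2.
    have vdh : (v *m (dfun a h p)^T) 0 0 = s.
      by rewrite -vg trmx_mul (metric_sym (manifold_laws Sigma) ap) mulmxA.
    have dhv' : (dfun a h p *m v^T) 0 0 = s by rewrite -vg.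
    have -> : v *m ((dfun a h p)^T *m dfun a h p) *m v^T =
      (v *m (dfun a h p)^T) *m (dfun a h p *m v^T) by rewrite !mulmxA.
    by rewrite mxE big_ord1 vdh dhv' expr2.
  have Es : (v *m ricci a p *m v^T) 0 0 - alpha * (v *m pullback a b1 u p *m v^T) 0 0
      + (v *m hess a h p *m v^T) 0 0 - mu p * s ^+ 2 = lam p * s.
    have := congr1 (fun W : 'M[R]_n => (v *m W *m v^T) 0 0)
      (einstein_ricci Sigma_einstein ap bp1).
    rewrite /= -dh2 /s; move: (pullback a b1 u p) (dfun a h p) (ricci a p) (hess a h p) (metric a p).
    move=> pb dh ri he g; rewrite !(mulmxBr, mulmxDr, mulmxBl, mulmxDl) -!scalemxAr -!scalemxAl.
    have E4 (W1 W2 W3 W4 : 'M[R]_1) :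
      (W1 - W2 + W3 - W4) 0 0 = W1 0 0 - W2 0 0 + W3 0 0 - W4 0 0 by rewrite !mxE.
    have E1 (c : R) (W : 'M[R]_1) : (c *: W) 0 0 = c * W 0 0 by rewrite mxE.
    by rewrite mulNmx -scalemxAl E4 !E1.
  have q_pos : 0 < mu p + derive1 f (h p) / f (h p).
    by have := mu_bound p; rewrite -subr_gt0 opprK.
  (* On v the structure equation reads (mu + f'/f) s^2 = Ric(v, v) - alpha u^*g'(v, v) + (theta rho
     + f'/f - lambda) s. By [Ric] and [alpha_pos] the right side is at most s times the bracket,
     hence nonpositive. *)
  have s2 : (mu p + derive1 f (h p) / f (h p)) * s ^+ 2 <= 0.
    have := mulr_ge0_le0 s_ge0 bracket; rewrite -(H_def a p ap) in Ric.
    move: Ric; rewrite Hess in Es.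
    move: Es alpha_pos; move: ((v *m ricci a p *m v^T) 0 0) (alpha * _) => r al Es al0 rle br.
    by lra.
  have s0 : s = 0.
    apply/eqP; rewrite -sqrf_eq0 eq_le sqr_ge0 andbT.
    by rewrite -(pmulr_rle0 _ q_pos).
  have v0 : v = 0.
    apply/eqP/negP => /negP v0; have := metric_pos (manifold_laws Sigma) ap v0.
    by rewrite /inner -/s s0 ltxx.
  by rewrite -vg v0 mul0mx.
move=> Delta; split=> [D0|D0 rho_le].
  apply: (dfun0_const (einstein_connected Sigma_einstein) (einstein_h Sigma_einstein)).
  move=> a p ap; apply: key ap; apply: quadratic_le0; left; exact: D0.
apply: (dfun0_const (einstein_connected Sigma_einstein) (einstein_h Sigma_einstein)).
move=> a p ap; apply: key ap; apply: quadratic_le0; right; split; [exact: D0|exact: rho_le].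
Qed.
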